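(* Let $(A,L)$ be an extended complete spectral metric space, let $\mathbb{F}=(f_1,\ldots,f_k)$ be a dual iterated function system on $A$ with $\Lambda^\infty_L(\mathbb{F})<1$, and let $\phi_0\in\mathcal{S}(A)$ be such that $\max_{i=1,\ldots,k}d_L(\phi_0,f_i^*(\phi_0))<\infty$. For any $\pi\in\mathring{\Delta}^k$, the two sequences $(\phi^M)_{M=1}^\infty,(\phi_M)_{M=1}^\infty\subset\mathcal{S}(A)$ defined by $$\phi^M:=\sum_{\omega\in\{1,\ldots,k\}^M}\pi_\omega\phi_\omega\quad\text{and}\quad \phi_M:=(\pi\cdot\mathbb{F}^* )^M(\phi_0)$$ are both $d_L$-convergent and have the same $d_L$-limit $\phi_\pi$. In particular, $\phi_\pi$ is the unique $(\pi\cdot\mathbb{F}^* )$-self-similar state within a finite $d_L$-distance of $\phi_0$.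
   Context: Let $A$ be a $C^*$-algebra, $A^{\mathrm{sa}}$ its self-adjoint part, $M(A)$ its multiplier algebra with self-adjoint part $M(A)^{\mathrm{sa}}$. $\mathcal{S}(A)$ denotes the states of $A$, identified with the strictly continuous states of $M(A)$. An extended complete spectral metric space is a pair $(A,L)$ where $L:A^{\mathrm{sa}}\to[0,\infty]$ is an extended semi-norm such that (1) $\{c\in A^{\mathrm{sa}}: L(c)<\infty\}$ is norm dense in $A^{\mathrm{sa}}$; (2) there is an approximate identity $(I_n)$ of $A$ (a net of positive contractions) with $L(I_n)\to0$; (3) $L$ is norm lower semicontinuous, i.e. $\{b\in A^{\mathrm{sa}}:L(b)\le c\}$ is norm closed for all $c\ge 0$. Put $d_L(\phi,\psi)=\sup\{|\phi(b)-\psi(b)| : b\in A^{\mathrm{sa}},L(b)\le1\}\in[0,\infty]$ for $\phi,\psi\in\mathcal{S}(A)$. Standing assumption: for all $b\in A^{\mathrm{sa}}$, $L(b)=\inf\{C>0: |\phi(b)-\psi(b)|\le C\,d_L(\phi,\psi)\ \forall \phi,\psi\in\mathcal{S}(A)\}$. The same formula extends $L$ to $M(A)^{\mathrm{sa}}$. A $*$-homomorphism $f:A\to M(B)$ is relatively proper if there is an increasing approximate identity $(I_n)$ of $A$ with $f(I_n)\to I\in M(B)$ strictly; such $f$ extends uniquely to a unital $*$-homomorphism $M(A)\to M(B)$ that is strictly continuous on the unit ball, also denoted $f$; compositions are taken using these extensions. A dual iterated function system on $A$ is a finite list $\mathbb{F}=(f_1,\ldots,f_k)$ of relatively proper $*$-homomorphisms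 $f_i:A\to M(A)$. For relatively proper $f:A\to M(A)$ and $\phi\in\mathcal{S}(A)$, $f^*\phi=\phi\circ f\in\mathcal{S}(A)$. $\mathring{\Delta}^k=\{(\pi_1,\ldots,\pi_k)\in(0,1)^k:\sum_i\pi_i=1\}$; $(\pi\cdot\mathbb{F}^* )\phi=\sum_{i=1}^k\pi_i f_i^*\phi$; $\phi\in\mathcal{S}(A)$ is $(\pi\cdot\mathbb{F}^* )$-self-similar if $\phi=(\pi\cdot\mathbb{F}^* )(\phi)$. $\Lambda_L(f)=\sup\{L(f(b)):b\in A^{\mathrm{sa}},L(b)\le1\}$ and $\Lambda^\infty_L(\mathbb{F})=\max_{i=1,\ldots,k}\Lambda_L(f_i)$. For $\omega=(\omega_1,\ldots,\omega_M)\in\{1,\ldots,k\}^M$, $\pi_\omega=\prod_{m=1}^M\pi_{\omega_m}$ and $f_\omega=f_{\omega_1}\circ\cdots\circ f_{\omega_M}$. Under the hypotheses of the claim, the Banach fixed point theorem gives that $f_\omega^*$ has a unique fixed state within a finite $d_L$-distance of $\phi_0$; this state is denoted $\phi_\omega$. *)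

(* Defs.v *)
From HB Require Import structures.
From mathcomp Require Import all_boot all_order all_algebra.
From mathcomp Require Import complex.
From mathcomp Require Import boolp classical_sets functions reals ereal.
From mathcomp Require Import topology normedtype sequences.

Set Implicit Arguments.
Unset Strict Implicit.
Unset Printing Implicit Defensive.

Import Order.TTheory GRing.Theory Num.Theory.
Import numFieldNormedType.Exports.

Local Open Scope classical_set_scope.
Local Open Scope complex_scope.
Local Open Scope ring_scope.

(* Complex *-algebras are not assumed unital, so the multiplication is a new
   operation on an [lmodType] instead of a library ring structure. *)
HB.mixin Record isStarAlgebra (R : realType) V of GRing.Lmodule R[i] V := {
  amul : V -> V -> V;
  star : V -> V;
  amulA : associative amul;
  amulDl : left_distributive amul +%R;
  amulDr : right_distributive amul +%R;
  amulZl : forall (c : R[i]) x y, amul (c *: x) y = c *: amul x y;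
  amulZr : forall (c : R[i]) x y, amul x (c *: y) = c *: amul x y;
  starD : forall x y, star (x + y) = star x + star y;
  starZ : forall (c : R[i]) x, star (c *: x) = Num.conj c *: star x;
  starM : forall x y, star (amul x y) = amul (star y) (star x);
  starK : involutive star
}.

#[short(type="starAlgType")]
HB.structure Definition StarAlgebra (R : realType) :=
  {V of isStarAlgebra R V & GRing.Lmodule R[i] V}.

Notation "x ** y" := (amul x y) (at level 40, left associativity) : ring_scope.

HB.mixin Record isCStarAlgebra (R : realType) V
    of StarAlgebra R V & CompleteNormedModule R[i] V := {
  norm_amul_le : forall x y : V, `|x ** y| <= `|x| * `|y|;
  norm_cstar : forall x : V, `|star x ** x| = `|x| ^+ 2
}.

#[short(type="cstarAlgType")]
HB.structure Definition CStarAlgebra (R : realType) :=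
  {V of isCStarAlgebra R V & StarAlgebra R V & CompleteNormedModule R[i] V}.

(* In the library, norms over the scalar field R[i] take their values in R[i];
   [rnorm] is the same norm seen as a real number. *)
Definition rnorm (R : realType) (V : normedZmodType R[i]) (x : V) : R :=
  complex.Re `|x|.

Definition selfadjoint (R : realType) (V : starAlgType R) (x : V) : Prop :=
  star x = x.

Definition positive (R : realType) (V : starAlgType R) (x : V) : Prop :=
  exists y : V, x = star y ** y.

Definition star_hom (R : realType) (V W : starAlgType R) (f : V -> W) : Prop :=
  [/\ linear f, forall x y, f (x ** y) = f x ** f y
    & forall x, f (star x) = star (f x)].

Section StarAlgebraTheory.
Variables (R : realType) (V : starAlgType R).
Implicit Types (x y : V).

Lemma star0 : star (0 : V) = 0.
Proof. by rewrite -(scale0r (0 : V)) starZ rmorph0 !scale0r. Qed.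

Lemma starN x : star (- x) = - star x.
Proof. by rewrite -scaleN1r starZ rmorphN rmorph1 scaleN1r. Qed.

Lemma amul0l x : 0 ** x = 0.
Proof. by rewrite -(scale0r (0 : V)) amulZl !scale0r. Qed.

Lemma amul0r x : x ** 0 = 0.
Proof. by rewrite -(scale0r (0 : V)) amulZr !scale0r. Qed.

Lemma amulNl x y : (- x) ** y = - (x ** y).
Proof. by rewrite -scaleN1r amulZl scaleN1r. Qed.

Lemma amulNr x y : x ** (- y) = - (x ** y).
Proof. by rewrite -scaleN1r amulZr scaleN1r. Qed.

End StarAlgebraTheory.

Lemma norm_star (R : realType) (A : cstarAlgType R) (x : A) :
  `|star x| = `|x|.
Proof.
suff le (y : A) : `|y| <= `|star y|.
  by apply/le_anti; rewrite le /= -{2}(starK x) le.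
have [->|y0] := eqVneq y 0; first by rewrite star0.
by rewrite -(ler_pM2r (_ : 0 < `|y|)) ?normr_gt0// -expr2 -norm_cstar
  norm_amul_le.
Qed.

(* The multiplier algebra M(A) is the algebra of double centralizers: the
   multiplier m is the pair of bounded maps a |-> m a and a |-> a m. *)
Definition double_centralizer (R : realType) (A : cstarAlgType R)
    (l r : A -> A) : Prop :=
  [/\ linear l /\ (exists C : R[i], forall a, `|l a| <= C * `|a|),
      linear r /\ (exists C : R[i], forall a, `|r a| <= C * `|a|),
      forall a b, l (a ** b) = l a ** b,
      forall a b, r (a ** b) = a ** r b
    & forall a b, r a ** b = a ** l b].

Record multiplier (R : realType) (A : cstarAlgType R) := Multiplier {
  lmult : A -> A;
  rmult : A -> A;
  multiplierP : double_centralizer lmult rmult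
}.

HB.instance Definition _ (R : realType) (A : cstarAlgType R) :=
  gen_eqMixin (multiplier A).
HB.instance Definition _ (R : realType) (A : cstarAlgType R) :=
  gen_choiceMixin (multiplier A).

Section MultiplierAlgebra.
Variables (R : realType) (A : cstarAlgType R).
Local Notation M := (multiplier A).
Implicit Types (m n : M) (a b : A) (c : R[i]).

Lemma multiplier_ext m n : lmult m =1 lmult n -> rmult m =1 rmult n -> m = n.
Proof.
case: m n => [l r H] [l' r' H'] /= /funext El /funext Er.
by move: H H'; rewrite El Er => H H'; congr Multiplier; exact: Prop_irrelevance.
Qed.

Lemma lmult_linear m : linear (lmult m).
Proof. by case: (multiplierP m) => -[]. Qed.

Lemma rmult_linear m : linear (rmult m).
Proof. by case: (multiplierP m) => _ -[]. Qed.

Lemma lmultM m a b : lmult m (a ** b) = lmult m a ** b.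
Proof. by case: (multiplierP m). Qed.

Lemma rmultM m a b : rmult m (a ** b) = a ** rmult m b.
Proof. by case: (multiplierP m). Qed.

Lemma rlmult m a b : rmult m a ** b = a ** lmult m b.
Proof. by case: (multiplierP m). Qed.

Let bounded_norm (f : A -> A) :
  (exists C : R[i], forall a, `|f a| <= C * `|a|) ->
  exists2 C : R[i], 0 <= C & forall a, `|f a| <= C * `|a|.
Proof.
move=> [C hC]; exists `|C| => // a; apply: (le_trans (hC a)).
have Ca0 : 0 <= C * `|a| by apply: le_trans (hC a).
by rewrite -[leLHS](ger0_norm Ca0) normrM normr_id.
Qed.

Lemma lmult_bounded m :
  exists2 C : R[i], 0 <= C & forall a, `|lmult m a| <= C * `|a|.
Proof. by case: (multiplierP m) => -[_ /bounded_norm]. Qed.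

Lemma rmult_bounded m :
  exists2 C : R[i], 0 <= C & forall a, `|rmult m a| <= C * `|a|.
Proof. by case: (multiplierP m) => _ -[_ /bounded_norm]. Qed.

Fact mult_zero_subproof : double_centralizer (fun _ : A => 0) (fun _ : A => 0).
Proof.
split; first 1 last.
- split; first by move=> c a b; rewrite scaler0 addr0.
  by exists 0 => a; rewrite normr0 mul0r.
- by move=> a b; rewrite amul0l.
- by move=> a b; rewrite amul0r.
- by move=> a b; rewrite amul0l amul0r.
- split; first by move=> c a b; rewrite scaler0 addr0.
  by exists 0 => a; rewrite normr0 mul0r.
Qed.
Definition mult_zero : M := Multiplier mult_zero_subproof.

Fact mult_add_subproof m n : double_centralizer
  (fun a => lmult m a + lmult n a) (fun a => rmult m a + rmult n a).
Proof.
have [C1 _ h1] := lmult_bounded m; have [C2 _ h2] := lmult_bounded n.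
have [D1 _ k1] := rmult_bounded m; have [D2 _ k2] := rmult_bounded n.
split.
- split; first by move=> c a b; rewrite !lmult_linear scalerDr addrACA.
  by exists (C1 + C2) => a; rewrite mulrDl (le_trans (ler_normD _ _))// lerD.
- split; first by move=> c a b; rewrite !rmult_linear scalerDr addrACA.
  by exists (D1 + D2) => a; rewrite mulrDl (le_trans (ler_normD _ _))// lerD.
- by move=> a b; rewrite !lmultM amulDl.
- by move=> a b; rewrite !rmultM amulDr.
- by move=> a b; rewrite amulDl amulDr !rlmult.
Qed.
Definition mult_add m n : M := Multiplier (mult_add_subproof m n).

Fact mult_scale_subproof c m : double_centralizer
  (fun a => c *: lmult m a) (fun a => c *: rmult m a).
Proof.
have [C _ h] := lmult_bounded m; have [D _ k] := rmult_bounded m.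
split.
- split; first by move=> d a b; rewrite lmult_linear scalerDr !scalerA mulrC.
  by exists (`|c| * C) => a; rewrite normrZ -mulrA ler_wpM2l.
- split; first by move=> d a b; rewrite rmult_linear scalerDr !scalerA mulrC.
  by exists (`|c| * D) => a; rewrite normrZ -mulrA ler_wpM2l.
- by move=> a b; rewrite lmultM amulZl.
- by move=> a b; rewrite rmultM amulZr.
- by move=> a b; rewrite amulZl amulZr rlmult.
Qed.
Definition mult_scale c m : M := Multiplier (mult_scale_subproof c m).

Fact mult_mul_subproof m n : double_centralizer
  (lmult m \o lmult n) (rmult n \o rmult m).
Proof.
have [C1 C10 h1] := lmult_bounded m; have [C2 _ h2] := lmult_bounded n.
have [D1 _ k1] := rmult_bounded m; have [D2 D20 k2] := rmult_bounded n.
split.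
- split; first by move=> d a b /=; rewrite !lmult_linear.
  exists (C1 * C2) => a /=; rewrite (le_trans (h1 _))//.
  by rewrite -mulrA ler_wpM2l.
- split; first by move=> d a b /=; rewrite !rmult_linear.
  exists (D2 * D1) => a /=; rewrite (le_trans (k2 _))//.
  by rewrite -mulrA ler_wpM2l.
- by move=> a b /=; rewrite !lmultM.
- by move=> a b /=; rewrite !rmultM.
- by move=> a b /=; rewrite !rlmult.
Qed.
Definition mult_mul m n : M := Multiplier (mult_mul_subproof m n).

Fact mult_star_subproof m : double_centralizer
  (fun a => star (rmult m (star a))) (fun a => star (lmult m (star a))).
Proof.
have [C _ h] := lmult_bounded m; have [D _ k] := rmult_bounded m.
split.
- split; first by move=> d a b; rewrite !(starD, starZ) rmult_linear
    !(starD, starZ) conjCK.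
  by exists D => a; rewrite norm_star -(norm_star a).
- split; first by move=> d a b; rewrite !(starD, starZ) lmult_linear
    !(starD, starZ) conjCK.
  by exists C => a; rewrite norm_star -(norm_star a).
- by move=> a b; rewrite starM rmultM starM starK.
- by move=> a b; rewrite starM lmultM starM starK.
- by move=> a b; rewrite -{1}(starK b) -starM -rlmult starM starK.
Qed.
Definition mult_star m : M := Multiplier (mult_star_subproof m).

Fact mult_one_subproof : double_centralizer (@id A) (@id A).
Proof. by split=> //; (split; [by []|exists 1 => a; rewrite mul1r]). Qed.
Definition mult_one : M := Multiplier mult_one_subproof.

Fact mult_embed_subproof (x : A) :
  double_centralizer (fun a => x ** a) (fun a => a ** x).
Proof.
split.
- split; first by move=> d a b; rewrite amulDr amulZr.
  by exists `|x| => a; exact: norm_amul_le.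
- split; first by move=> d a b; rewrite amulDl amulZl.
  by exists `|x| => a; rewrite mulrC; exact: norm_amul_le.
- by move=> a b; rewrite amulA.
- by move=> a b; rewrite amulA.
- by move=> a b; rewrite amulA.
Qed.
Definition mult_embed (x : A) : M := Multiplier (mult_embed_subproof x).

Fact mult_addA : associative mult_add.
Proof. by move=> m n p; apply: multiplier_ext => a /=; rewrite addrA. Qed.

Fact mult_addC : commutative mult_add.
Proof. by move=> m n; apply: multiplier_ext => a /=; rewrite addrC. Qed.

Fact mult_add0 : left_id mult_zero mult_add.
Proof. by move=> m; apply: multiplier_ext => a /=; rewrite add0r. Qed.

Fact mult_addN : left_inverse mult_zero (mult_scale (-1)) mult_add.
Proof.
by move=> m; apply: multiplier_ext => a /=; rewrite scaleN1r addNr.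
Qed.

HB.instance Definition _ :=
  GRing.isZmodule.Build M mult_addA mult_addC mult_add0 mult_addN.

Fact mult_scaleA c d m : mult_scale c (mult_scale d m) = mult_scale (c * d) m.
Proof. by apply: multiplier_ext => a /=; rewrite scalerA. Qed.

Fact mult_scale1 : left_id 1 mult_scale.
Proof. by move=> m; apply: multiplier_ext => a /=; rewrite scale1r. Qed.

Fact mult_scaleDr : right_distributive mult_scale +%R.
Proof. by move=> c m n; apply: multiplier_ext => a /=; rewrite scalerDr. Qed.

Fact mult_scaleDl m : {morph mult_scale^~ m : c d / c + d}.
Proof. by move=> c d; apply: multiplier_ext => a /=; rewrite scalerDl. Qed.

HB.instance Definition _ := GRing.Zmodule_isLmodule.Build R[i] M
  mult_scaleA mult_scale1 mult_scaleDr mult_scaleDl.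

Fact mult_mulA : associative mult_mul.
Proof. by move=> m n p; apply: multiplier_ext. Qed.

Let linD (f : A -> A) : linear f -> {morph f : x y / x + y}.
Proof. by move=> lf x y; rewrite -[x]scale1r lf !scale1r. Qed.

Let linZ (f : A -> A) : linear f -> forall c x, f (c *: x) = c *: f x.
Proof.
move=> lf c x; have f0 : f 0 = 0.
  by apply: (@addrI _ (f 0)); rewrite -(linD lf) !addr0.
by have := lf c x 0; rewrite !addr0 f0 addr0.
Qed.

Fact mult_mulDl : left_distributive mult_mul +%R.
Proof.
move=> m n p; apply: multiplier_ext => a //=.
by rewrite (linD (rmult_linear p)).
Qed.

Fact mult_mulDr : right_distributive mult_mul +%R.
Proof.
move=> m n p; apply: multiplier_ext => a //=.
by rewrite (linD (lmult_linear m)).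
Qed.

Fact mult_mulZl c m n : mult_mul (c *: m) n = c *: mult_mul m n.
Proof.
apply: multiplier_ext => a //=.
by rewrite (linZ (rmult_linear n)).
Qed.

Fact mult_mulZr c m n : mult_mul m (c *: n) = c *: mult_mul m n.
Proof.
apply: multiplier_ext => a //=.
by rewrite (linZ (lmult_linear m)).
Qed.

Fact mult_starD m n : mult_star (m + n) = mult_star m + mult_star n.
Proof. by apply: multiplier_ext => a /=; rewrite starD. Qed.

Fact mult_starZ c m : mult_star (c *: m) = Num.conj c *: mult_star m.
Proof. by apply: multiplier_ext => a /=; rewrite starZ. Qed.

Fact mult_starM m n :
  mult_star (mult_mul m n) = mult_mul (mult_star n) (mult_star m).
Proof. by apply: multiplier_ext => a /=; rewrite starK. Qed.

Fact mult_starK : involutive mult_star.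
Proof. by move=> m; apply: multiplier_ext => a /=; rewrite !starK. Qed.

HB.instance Definition _ := isStarAlgebra.Build R M mult_mulA mult_mulDl
  mult_mulDr mult_mulZl mult_mulZr mult_starD mult_starZ mult_starM mult_starK.

End MultiplierAlgebra.

(* The strict topology, generated by the seminorms m |-> `|m a| and
   m |-> `|a m|, is the topology carried by [multiplier A]; the norm topology
   of M(A) only enters through [mult_norm]. *)
Definition mult_pair (R : realType) (A : cstarAlgType R) (m : multiplier A) :
    {ptws A -> A} * {ptws A -> A} := (lmult m, rmult m).

HB.instance Definition _ (R : realType) (A : cstarAlgType R) :=
  Topological.copy (multiplier A) (initial_topology (@mult_pair R A)).

Definition mult_norm (R : realType) (A : cstarAlgType R) (m : multiplier A)
    : R :=
  sup [set rnorm (lmult m a) | a in [set a : A | rnorm a <= 1]].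

(* Nets. [tails le] is the filter of eventual subsets of the index set. *)
Definition directed (D : Type) (le : D -> D -> Prop) : Prop :=
  [/\ inhabited D, forall d, le d d,
      forall d e f, le d e -> le e f -> le d f
    & forall d e, exists f, le d f /\ le e f].

Definition tails (D : Type) (le : D -> D -> Prop) : set_system D :=
  filter_from setT (fun d => [set e | le d e]).

Definition approximate_identity (R : realType) (A : cstarAlgType R)
    (D : Type) (le : D -> D -> Prop) (u : D -> A) : Prop :=
  [/\ directed le,
      forall d, positive (u d) /\ rnorm (u d) <= 1,
      forall a, u d ** a @[d --> tails le] --> a
    & forall a, a ** u d @[d --> tails le] --> a].

Definition relatively_proper (R : realType) (A B : cstarAlgType R)
    (f : A -> multiplier B) : Prop :=
  star_hom f /\
  exists (D : Type) (le : D -> D -> Prop) (u : D -> A),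
    [/\ approximate_identity le u,
        forall d e, le d e -> positive (u e - u d)
      & f (u d) @[d --> tails le] --> mult_one B].

Definition is_strict_extension (R : realType) (A B : cstarAlgType R)
    (f : A -> multiplier B) (g : multiplier A -> multiplier B) : Prop :=
  [/\ star_hom g, g (mult_one A) = mult_one B,
      forall a, g (mult_embed a) = f a
    & {within [set m | mult_norm m <= 1], continuous g}].

(* The unique extension of a relatively proper f to the multiplier algebras. *)
Definition strict_extension (R : realType) (A B : cstarAlgType R)
    (f : A -> multiplier B) : multiplier A -> multiplier B :=
  xget (fun=> 0) [set g | is_strict_extension f g].

(* States of a *-algebra with norm [N]: positive functionals of norm one. *)
Definition is_state_for (R : realType) (V : starAlgType R) (N : V -> R)
    (phi : V -> R[i]) : Prop :=
  [/\ scalar phi, forall x, 0 <= phi (star x ** x)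
    & ereal_sup [set (rnorm (phi x))%:E | x in [set x | N x <= 1]] = 1%E].

Definition is_state (R : realType) (A : cstarAlgType R) (phi : A -> R[i]) :=
  is_state_for (fun a : A => rnorm a) phi.

(* The strictly continuous state of M(A) identified with a state of A. *)
Definition state_extension (R : realType) (A : cstarAlgType R)
    (phi : A -> R[i]) : multiplier A -> R[i] :=
  xget (fun=> 0) [set Phi | [/\ is_state_for (@mult_norm R A) Phi,
    continuous (Phi : multiplier A -> R[i]^o)
    & forall a, Phi (mult_embed a) = phi a]].

Definition pullback (R : realType) (A B : cstarAlgType R)
    (f : A -> multiplier B) (phi : B -> R[i]) : A -> R[i] :=
  fun a => state_extension phi (f a).

Section SpectralMetric.
Variables (R : realType) (A : cstarAlgType R).
Local Open Scope ereal_scope.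

(* Extended semi-norms on the real vector space of self-adjoint elements are
   functions on A of which only the values at self-adjoint elements matter. *)
Variable L : A -> \bar R.

Definition extended_seminorm : Prop :=
  [/\ forall b, selfadjoint b -> 0 <= L b,
      forall (c : R) b, selfadjoint b -> L (c%:C%C *: b)%R = `|c|%:E * L b
    & forall a b, selfadjoint a -> selfadjoint b -> L (a + b)%R <= L a + L b].

Definition complete_spectral_metric_space : Prop :=
  [/\ extended_seminorm,
      [set b | selfadjoint b] `<=` closure [set b | selfadjoint b /\ L b < +oo],
      exists (D : Type) (le : D -> D -> Prop) (u : D -> A),
        approximate_identity le u /\ L (u d) @[d --> tails le] --> 0
    & forall c : R, (0 <= c)%R ->
        closed [set b | selfadjoint b /\ L b <= c%:E]].

Definition state_dist (phi psi : A -> R[i]) : \bar R :=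
  ereal_sup [set (rnorm (phi b - psi b)%R)%:E
            | b in [set b | selfadjoint b /\ L b <= 1]].

Definition lipschitz_constant (h : (A -> R[i]) -> R[i]) : \bar R :=
  ereal_inf [set C%:E | C in [set C : R | (0 < C)%R /\
    forall phi psi, is_state phi -> is_state psi ->
      (rnorm (h phi - h psi)%R)%:E <= C%:E * state_dist phi psi]].

Definition mult_seminorm (m : multiplier A) : \bar R :=
  lipschitz_constant (fun phi => state_extension phi m).

Definition dilation (f : A -> multiplier A) : \bar R :=
  ereal_sup [set mult_seminorm (f b)
            | b in [set b | selfadjoint b /\ L b <= 1]].

Definition max_dilation (k : nat) (F : 'I_k -> A -> multiplier A) : \bar R :=
  \big[maxe/-oo]_(i < k) dilation (F i).

End SpectralMetric.

Section DualIFS.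
Variables (R : realType) (A : cstarAlgType R).
Variables (k : nat) (F : 'I_k -> A -> multiplier A) (p : 'I_k -> R).

Definition open_simplex : Prop :=
  (forall i, 0 < p i < 1) /\ \sum_(i < k) p i = 1.

Definition markov_op (phi : A -> R[i]) : A -> R[i] :=
  fun a => \sum_(i < k) (p i)%:C * pullback (F i) phi a.

Definition self_similar (phi : A -> R[i]) : Prop := phi = markov_op phi.

Definition word_weight (w : seq 'I_k) : R := \prod_(i <- w) p i.

(* f_(w_1) o ... o f_(w_M), the maps being composed through their extensions
   to M(A). *)
Definition word_map (w : seq 'I_k) : A -> multiplier A :=
  foldr (fun i g => strict_extension (F i) \o g) (@mult_embed R A) w.

Variables (L : A -> \bar R) (phi0 : A -> R[i]).

Definition word_state (w : seq 'I_k) : A -> R[i] :=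
  xget (fun=> 0) [set phi | [/\ is_state phi, pullback (word_map w) phi = phi
    & (state_dist L phi0 phi < +oo)%E]].

Definition word_average (M : nat) : A -> R[i] :=
  fun a => \sum_(w : M.-tuple 'I_k) (word_weight w)%:C * word_state w a.

Definition markov_iterate (M : nat) : A -> R[i] := iter M markov_op phi0.

End DualIFS.

(* Main.v *)
(* Positivity makes a state [phi] of [A] almost invariant under right
   multiplication by the squares of an approximate unit, so that Cohen's
   factorization argument yields [b] in [A] with [|phi a| <= 3 |a b|]. Hence
   [m |-> lim phi (m u_d)] is a strictly continuous extension of [phi] to the
   multiplier algebra. A relatively proper [f] extends strictly continuously to
   multipliers by [g m (f a b) = f (m a) b], because *-homomorphisms are
   contractive. So the maps [f_w^*] and [pi . F^*] act on states, and they are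
   strict contractions for [d_L] since [Lambda_L < 1]. The approximate identity
   with [L -> 0] prevents loss of mass in the limit, so [d_L] is complete on
   states at finite distance and Banach's theorem gives [phi_w] and [phi_pi].
   Finally [(pi . F^* )^M phi_0] is the average of the [f_w^* phi_0] over words
   of length [M], each within [O (q^M)] of [phi_w = f_w^* phi_w]. *)

Require Import Defs.
From HB Require Import structures.
From mathcomp Require Import all_boot all_order all_algebra.
From mathcomp Require Import complex.
From mathcomp Require Import boolp classical_sets functions reals ereal.
From mathcomp Require Import topology normedtype sequences.
From mathcomp Require Import ring lra.

Set Implicit Arguments.
Unset Strict Implicit.
Unset Printing Implicit Defensive.

Import Order.TTheory GRing.Theory Num.Theory.
Import numFieldNormedType.Exports.

Local Open Scope classical_set_scope.
Local Open Scope complex_scope.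
Local Open Scope ring_scope.

(** * Norms and limits *)

(** No spectral theory enters. Cauchy-Schwarz, the C*-identity and geometric recursions do the work,
    and since [A] has no unit, elements such as [1 - t] or [1/2 + c] are handled through their parts
    [t], [c] in [A]. Two demands of the definitions shape the proof. [state_extension] asks for
    strict continuity on all multipliers, not only on bounded sets, so one strict seminorm has to
    dominate the functional; this is what the factorization supplies. [strict_extension] asks for
    continuity on the unit ball only, where contractivity is enough. Moreover [state_extension] and
    [word_state] are picked by [xget]: after existence, the former is identified as a limit along an
    approximate unit and the latter by uniqueness of a fixpoint, and only then can composition,
    convexity and explicit rates be proved. The rates are uniform in the word because each [f_i^*]
    preserves the ball of radius [d / (1 - q)] around [phi0]. *)

Section RealNorm.
Variables (R : realType) (V : normedZmodType R[i]).
Implicit Types x y z : V.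

Lemma normrE_rnorm x : `|x| = (rnorm x)%:C.
Proof. by rewrite /rnorm RRe_real// normr_real. Qed.

Lemma rnorm_ge0 x : 0 <= rnorm x.
Proof. by rewrite -(@ler0c R) -normrE_rnorm. Qed.

Lemma rnorm_leP x (e : R) : (rnorm x <= e) = (`|x| <= e%:C).
Proof. by rewrite normrE_rnorm lecR. Qed.

Lemma rnorm_ltP x (e : R) : (rnorm x < e) = (`|x| < e%:C).
Proof. by rewrite normrE_rnorm ltcR. Qed.

Lemma rnorm0 : rnorm (0 : V) = 0.
Proof. by rewrite /rnorm normr0. Qed.

Lemma rnorm0_eq0 x : rnorm x = 0 -> x = 0.
Proof. by move=> h; apply: normr0_eq0; rewrite normrE_rnorm h. Qed.

Lemma rnormN x : rnorm (- x) = rnorm x.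
Proof. by rewrite /rnorm normrN. Qed.

Lemma rnorm_distC x y : rnorm (x - y) = rnorm (y - x).
Proof. by rewrite /rnorm distrC. Qed.

Lemma rnormD x y : rnorm (x + y) <= rnorm x + rnorm y.
Proof.
by rewrite rnorm_leP rmorphD /= -!normrE_rnorm ler_normD.
Qed.

Lemma rnormB x y : rnorm (x - y) <= rnorm x + rnorm y.
Proof. by rewrite -[rnorm y]rnormN rnormD. Qed.

Lemma rnorm_dist z x y : rnorm (x - y) <= rnorm (x - z) + rnorm (z - y).
Proof. by apply: le_trans (rnormD _ _); rewrite addrA subrK. Qed.

Lemma rnorm_le0 x : rnorm x <= 0 -> x = 0.
Proof. by move=> h; apply/rnorm0_eq0/le_anti; rewrite h rnorm_ge0. Qed.

Lemma rnorm_eq x y : (forall e : R, 0 < e -> rnorm (x - y) <= e) -> x = y.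
Proof.
move=> h; apply/eqP; rewrite -subr_eq0; apply/eqP/rnorm_le0.
by apply/ler_addgt0Pl => e e0; rewrite addr0 h.
Qed.

End RealNorm.

Section ComplexModulus.
Variable R : realType.
Implicit Types (z w : R[i]) (r : R).

Lemma rnormCM z w : rnorm (z * w) = rnorm z * rnorm w.
Proof. by rewrite /rnorm normrM !normrE_rnorm -rmorphM. Qed.

Lemma rnormCr r : rnorm (r%:C : R[i]) = `|r|.
Proof. by rewrite /rnorm normc_def /= expr0n /= addr0 sqrtr_sqr. Qed.

Lemma rnorm_ger0 z : 0 <= z -> z = (rnorm z)%:C.
Proof. by move=> z0; rewrite -normrE_rnorm ger0_norm. Qed.

Lemma ler_Re_rnorm z : `|complex.Re z| <= rnorm z.
Proof. by rewrite -lecR -normrE_rnorm normc_ge_Re. Qed.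

Lemma rnorm_le_ReIm z : rnorm z <= `|complex.Re z| + `|complex.Im z|.
Proof.
rewrite {1}[z]complexE; apply: le_trans (rnormD _ _) _.
by rewrite rnormCM !rnormCr [rnorm 'i]/rnorm normc_def /= expr0n /= add0r
  expr1n sqrtr1 mul1r.
Qed.

Lemma ler_Im_rnorm z : `|complex.Im z| <= rnorm z.
Proof.
have /= := ler_Re_rnorm (z * 'i%C); rewrite ReiNIm normrN rnormCM.
by rewrite [rnorm 'i]/rnorm normc_def /= expr0n /= add0r expr1n sqrtr1 mulr1.
Qed.

End ComplexModulus.

Section Convergence.
Variables (R : realType) (V : completeNormedModType R[i]).

Lemma rnormZ (c : R[i]) (x : V) : rnorm (c *: x) = rnorm c * rnorm x.
Proof. by rewrite /rnorm normrZ !normrE_rnorm -rmorphM. Qed.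

Lemma rnormZr (r : R) (x : V) : rnorm (r%:C *: x) = `|r| * rnorm x.
Proof. by rewrite rnormZ rnormCr. Qed.

(** Positive elements of [R[i]] are real, so every epsilon can be taken in [R], where [lra] and
    [nra] apply. *)
Lemma cvg_rnormP (T : Type) (F : set_system T) (FF : Filter F) (f : T -> V) y :
  f x @[x --> F] --> y <->
  (forall e : R, 0 < e -> \forall x \near F, rnorm (f x - y) < e).
Proof.
split=> [/cvgrPdist_lt h e e0|h].
  have e0' : 0 < e%:C :> R[i] by rewrite ltcR.
  by apply: filterS (h _ e0') => x; rewrite rnorm_distC rnorm_ltP.
apply/cvgrPdist_lt => e e0.
have [re0 ee] : 0 < complex.Re e /\ e = (complex.Re e)%:C.
  by move: e0; rewrite ltcE /= => /andP[/eqP ei er]; rewrite [e]complexE ei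
    mulr0 addr0.
by apply: filterS (h _ re0) => x; rewrite rnorm_distC rnorm_ltP -ee.
Qed.

Lemma cauchy_rnorm (T : Type) (F : set_system T) (FF : ProperFilter F)
    (f : T -> V) :
  (forall e : R, 0 < e -> exists x, \forall y \near F, rnorm (f y - f x) < e) ->
  exists l, forall e : R, 0 < e -> \forall x \near F, rnorm (f x - l) < e.
Proof.
move=> h; have : cvg (f x @[x --> F]).
  apply/cauchy_cvgP/cauchy_exP => e e0.
  have [re0 ee] : 0 < complex.Re e /\ e = (complex.Re e)%:C.
    by move: e0; rewrite ltcE /= => /andP[/eqP ei er]; rewrite [e]complexE ei
      mulr0 addr0.
  have [x hx] := h _ re0; exists (f x).
  apply: filterS hx => y; rewrite rnorm_distC rnorm_ltP -ee => hy.
  by rewrite -ball_normE.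
by move=> /cvg_ex[l hl]; exists l; apply/cvg_rnormP.
Qed.

Lemma geometric_small (q e C : R) : 0 <= q < 1 -> 0 < e ->
  \forall n \near \oo, C * q ^+ n < e.
Proof.
move=> /andP[q0 q1] e0.
have : (fun n => C * q ^+ n) @ \oo --> (0 : R).
  rewrite -(mulr0 C); apply: cvgM; first exact: cvg_cst.
  by apply: cvg_expr; rewrite ger0_norm.
move=> /cvgrPdist_lt /(_ e e0); apply: filterS => n.
by rewrite sub0r normrN; apply: le_lt_trans; rewrite ler_norm.
Qed.

(** Stated for an abstract [d], so that it serves norms of differences in [V] as well as values of
    states at one element. *)
Lemma geometric_dist (d : nat -> nat -> R) (C q : R) : 0 <= C -> 0 <= q < 1 ->
  (forall n, d n n <= 0) -> (forall n m p, d n p <= d n m + d m p) ->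
  (forall n, d n n.+1 <= C * q ^+ n) ->
  forall n m, (n <= m)%N -> d n m <= C / (1 - q) * q ^+ n.
Proof.
move=> C0 /andP[q0 q1] d0 dt hd n m /subnKC <-.
have q1' : 0 < 1 - q by rewrite subr_gt0.
pose D := C / (1 - q); have D0 : 0 <= D by rewrite divr_ge0// ltW.
have hC : C = D * (1 - q) by rewrite /D divfK// gt_eqF.
(* The exact partial geometric sum is the invariant that passes through the induction. *)
have key i : d n (n + i)%N <= D * q ^+ n * (1 - q ^+ i).
  elim: i => [|i IH]; first by rewrite addn0 subrr mulr0 d0.
  apply: le_trans (dt _ (n + i)%N _) _.
  rewrite addnS; apply: le_trans (lerD IH (hd _)) _.
  rewrite hC exprS exprD le_eqVlt; apply/orP; left; apply/eqP; ring.
apply: le_trans (key _) _; apply: ler_piMr.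
  by rewrite mulr_ge0 ?exprn_ge0.
by rewrite gerBl exprn_ge0.
Qed.

Lemma geometric_cvg (x : nat -> V) (C q : R) : 0 <= C -> 0 <= q < 1 ->
  (forall n, rnorm (x n.+1 - x n) <= C * q ^+ n) ->
  exists l, forall n, rnorm (x n - l) <= C / (1 - q) * q ^+ n.
Proof.
move=> C0 q01 hx; pose D := C / (1 - q).
have key n m : (n <= m)%N -> rnorm (x m - x n) <= D * q ^+ n.
  apply: (@geometric_dist (fun n m => rnorm (x m - x n))) => //.
    by move=> k; rewrite subrr rnorm0.
  by move=> i j k; rewrite [leRHS]addrC; exact: rnorm_dist.
have [|l hl] := @cauchy_rnorm _ \oo _ x.
  move=> e e0; have [N _ hN] := geometric_small D q01 e0.
  exists (x := N); exists N => // n /= Nn.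
  by apply: le_lt_trans (key _ _ Nn) _; apply: hN => /=.
exists l => n; apply/ler_addgt0Pr => e e0.
have [N _ hN] := hl _ e0.
apply: le_trans (rnorm_dist (x (maxn N n)) _ _) _.
apply: lerD; first by rewrite rnorm_distC key// leq_maxr.
by apply/ltW/hN; rewrite /= leq_maxl.
Qed.

End Convergence.

Section UnbundledLinear.
Variables (K : pzRingType) (U V : lmodType K) (f : U -> V).
Hypothesis lf : linear f.

Lemma linear_add x y : f (x + y) = f x + f y.
Proof. by rewrite -[x]scale1r lf !scale1r. Qed.

Lemma linear_zero : f 0 = 0.
Proof. by apply: (@addrI _ (f 0)); rewrite -linear_add !addr0. Qed.

Lemma linear_scale c x : f (c *: x) = c *: f x.
Proof. by have := lf c x 0; rewrite !addr0 linear_zero addr0. Qed.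

Lemma linear_opp x : f (- x) = - f x.
Proof. by rewrite -scaleN1r linear_scale scaleN1r. Qed.

Lemma linear_sub x y : f (x - y) = f x - f y.
Proof. by rewrite linear_add linear_opp. Qed.

End UnbundledLinear.

(** * Positive functionals and states *)

Section PositiveFunctionals.
Variables (R : realType) (V : starAlgType R) (phi : V -> R[i]).
Hypothesis sphi : scalar phi.
Implicit Types x y : V.

Lemma scalar_add x y : phi (x + y) = phi x + phi y.
Proof. exact: (linear_add (V := R[i]^o) sphi). Qed.

Lemma scalar_scale c x : phi (c *: x) = c * phi x.
Proof. exact: (linear_scale (V := R[i]^o) sphi). Qed.

Lemma scalar_zero : phi 0 = 0.
Proof. exact: (linear_zero (V := R[i]^o) sphi). Qed.

Lemma scalar_sub x y : phi (x - y) = phi x - phi y.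
Proof. exact: (linear_sub (V := R[i]^o) sphi). Qed.

Hypothesis pphi : forall x, 0 <= phi (star x ** x).

Let form z x y : phi (star (x + z *: y) ** (x + z *: y)) =
  phi (star x ** x) + z * phi (star x ** y) + Num.conj z * phi (star y ** x)
  + (Num.conj z * z) * phi (star y ** y).
Proof.
rewrite starD starZ !amulDl !amulDr !amulZl !amulZr scalerA.
by rewrite !scalar_add !scalar_scale !addrA.
Qed.

(** Positivity at [x + z y] makes [z phi (star x y) + conj z phi (star y x)] real; [z = 1] and
    [z = i] settle the two coordinates. *)
Lemma positive_hermitian x y :
  phi (star y ** x) = Num.conj (phi (star x ** y)).
Proof.
have h z : complex.Im (z * phi (star x ** y) + Num.conj z * phi (star y ** x))
    = 0.
  have := pphi (x + z *: y); rewrite form.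
  have zz : Num.conj z * z = (rnorm z ^+ 2)%:C.
    by rewrite mulrC -normCK normrE_rnorm rmorphXn.
  rewrite (rnorm_ger0 (pphi x)) (rnorm_ger0 (pphi y)) zz -rmorphM /=.
  move=> /ger0_Im; case: (z * _) => a b; case: (_ * phi _) => c d /=.
  by rewrite add0r addr0.
have := h 1; have := h 'i%C.
rewrite rmorph1 !mul1r.
case: (phi (star x ** y)) => a b; case: (phi (star y ** x)) => c d.
by rewrite /Num.conj /= => h1 h2; apply/eqP; rewrite eq_complex /=;
  apply/andP; split; apply/eqP; lra.
Qed.

Lemma positive_cauchy_schwarz x y :
  rnorm (phi (star x ** y)) ^+ 2 <=
  rnorm (phi (star x ** x)) * rnorm (phi (star y ** y)).
Proof.
set b := phi (star x ** y); set a := rnorm (phi (star x ** x)).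
set c := rnorm (phi (star y ** y)); move hB : (rnorm b ^+ 2) => B.
(* Positivity at [x + z y] with [z = - s conj b] is a real quadratic inequality in [s]. The choice
   [s = 1 / c] gives the claim; if [c = 0], then [s = (a + 1) / (2 B)] would give the value [-1]. *)
have h (s : R) : 0 <= a - 2 * s * B + s ^+ 2 * B * c.
  have := pphi (x + (- s%:C * Num.conj b) *: y).
  rewrite form (positive_hermitian x y) -/b (rnorm_ger0 (pphi x)) -/a.
  rewrite (rnorm_ger0 (pphi y)) -/c.
  have -> : Num.conj (- s%:C * Num.conj b) = - s%:C * b.
    case: (b) => b1 b2; rewrite /Num.conj /=.
    by apply/eqP; rewrite eq_complex /=; apply/andP; split; apply/eqP; ring.
  have bb : b * Num.conj b = B%:C by rewrite -hB -normCK normrE_rnorm rmorphXn.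
  rewrite -(@ler0c R) !(rmorphD, rmorphM, rmorphN, rmorphXn) /= -bb /=.
  set S := s%:C; set cb := Num.conj b; set aC := a%:C; set cC := c%:C.
  by congr (0 <= _); ring.
have c0 : 0 <= c by apply: rnorm_ge0.
have [cz|cn] := eqVneq c 0; last first.
  have cp : 0 < c by rewrite lt_def cn.
  have := h c^-1; rewrite -(ler_pM2l cp) mulr0.
  have -> : c * (a - 2 * c^-1 * B + c^-1 ^+ 2 * B * c) = a * c - B.
    by field.
  by rewrite subr_ge0.
rewrite cz mulr0 leNgt; apply/negP => B0.
have := h ((a + 1) / (2 * B)); rewrite cz mulr0 addr0.
have -> : a - 2 * ((a + 1) / (2 * B)) * B = - 1 by field; rewrite gt_eqF.
by rewrite lerNr oppr0 ler10.
Qed.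

End PositiveFunctionals.

(** * The C*-norm and approximate units *)

Section CStarNorm.
Variables (R : realType) (A : cstarAlgType R).
Implicit Types a x y : A.

Lemma rnormM x y : rnorm (x ** y) <= rnorm x * rnorm y.
Proof. by rewrite rnorm_leP rmorphM /= -!normrE_rnorm norm_amul_le. Qed.

Lemma rnorm_star x : rnorm (star x) = rnorm x.
Proof. by rewrite /rnorm norm_star. Qed.

Lemma rnorm_cstar x : rnorm (star x ** x) = rnorm x ^+ 2.
Proof. by apply: complexI; rewrite rmorphXn /= -!normrE_rnorm norm_cstar. Qed.

Lemma rnorm_cstar_r x : rnorm (x ** star x) = rnorm x ^+ 2.
Proof. by rewrite -{1}(starK x) rnorm_cstar rnorm_star. Qed.

Lemma rnormMl x y : rnorm x <= 1 -> rnorm (x ** y) <= rnorm y.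
Proof.
by move=> x1; apply: le_trans (rnormM _ _) _; rewrite ler_piMl ?rnorm_ge0.
Qed.

Lemma rnormMr x y : rnorm y <= 1 -> rnorm (x ** y) <= rnorm x.
Proof.
by move=> x1; apply: le_trans (rnormM _ _) _; rewrite ler_piMr ?rnorm_ge0.
Qed.

Lemma amulBl x y z : (x - y) ** z = x ** z - y ** z :> A.
Proof. by rewrite amulDl amulNl. Qed.

Lemma amulBr x y z : z ** (x - y) = z ** x - z ** y :> A.
Proof. by rewrite amulDr amulNr. Qed.

Lemma starB x y : star (x - y) = star x - star y.
Proof. by rewrite starD starN. Qed.

End CStarNorm.

(** A form of [approximate_identity] over an arbitrary filter, with self-adjoint contractions and
    real epsilons; it is stable under squaring. *)
Definition approx_unit (R : realType) (A : cstarAlgType R) (D : Type)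
    (F : set_system D) (u : D -> A) : Prop :=
  [/\ forall d, star (u d) = u d,
      forall d, rnorm (u d) <= 1,
      forall a (e : R), 0 < e -> \forall d \near F, rnorm (u d ** a - a) < e
    & forall a (e : R), 0 < e -> \forall d \near F, rnorm (a ** u d - a) < e].

Section ApproxUnit.
Variables (R : realType) (A : cstarAlgType R) (D : Type).

Lemma tails_proper (le : D -> D -> Prop) :
  directed le -> ProperFilter (tails le).
Proof.
move=> [[d0] lerefl letrans ledir]; apply: filter_from_proper; last first.
  by move=> d _; exists d; exact: lerefl.
apply: filter_from_filter; first by exists d0.
move=> d e _ _; have [f [df ef]] := ledir d e.
by exists f => // g /= fg; split; [apply: letrans df fg|apply: letrans ef fg].
Qed.

Lemma positive_selfadjoint (a : A) : positive a -> star a = a.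
Proof. by move=> [y ->]; rewrite starM starK. Qed.

Lemma approximate_identity_unit (le : D -> D -> Prop) (u : D -> A) :
  approximate_identity le u ->
  ProperFilter (tails le) /\ approx_unit (tails le) u.
Proof.
move=> [dle hu ul ur]; have FF := tails_proper dle; split=> //; split.
- by move=> d; apply/positive_selfadjoint; case: (hu d).
- by move=> d; case: (hu d).
- by move=> a; apply/cvg_rnormP.
- by move=> a; apply/cvg_rnormP.
Qed.

(** Squares are wanted because [u_d ** u_d = star u_d ** u_d] has the form on which positivity and
    Cauchy-Schwarz speak. *)
Lemma approx_unit_sqr (F : set_system D) (FF : Filter F) (u : D -> A) :
  approx_unit F u -> approx_unit F (fun d => u d ** u d).
Proof.
move=> [us u1 ul ur]; split.
- by move=> d; rewrite starM us.
- by move=> d; apply: le_trans (rnormMl _ (u1 d)) (u1 d).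
- move=> a e e0; have e20 : 0 < e / 2 by rewrite divr_gt0.
  apply: filterS (ul a _ e20) => d hd.
  apply: le_lt_trans (rnorm_dist (u d ** a) _ _) _.
  rewrite -amulA -amulBr; have := rnormMl (u d ** a - a) (u1 d); lra.
- move=> a e e0; have e20 : 0 < e / 2 by rewrite divr_gt0.
  apply: filterS (ur a _ e20) => d hd.
  apply: le_lt_trans (rnorm_dist (a ** u d) _ _) _.
  rewrite amulA -amulBl; have := rnormMr (a ** u d - a) (u1 d); lra.
Qed.

End ApproxUnit.

(** * States along approximate units *)

Section States.
Variables (R : realType) (A : cstarAlgType R).
Implicit Types (phi : A -> R[i]).

Lemma state_scalar phi : is_state phi -> scalar phi. Proof. by case. Qed.

Lemma state_ge0 phi : is_state phi -> forall x, 0 <= phi (star x ** x).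
Proof. by case. Qed.

Lemma scalar_bounded phi (C : R) : scalar phi ->
  (forall a, rnorm a <= 1 -> rnorm (phi a) <= C) ->
  forall a, rnorm (phi a) <= C * rnorm a.
Proof.
move=> sphi h a; have [->|a0] := eqVneq a 0.
  by rewrite scalar_zero// !rnorm0 mulr0.
have na : 0 < rnorm a.
  rewrite lt_def rnorm_ge0 andbT; apply: contra a0 => /eqP.
  by move=> /rnorm0_eq0 ->.
have := h ((rnorm a)^-1%:C *: a); rewrite scalar_scale// rnormZr rnormCM rnormCr.
rewrite ger0_norm ?invr_ge0 ?rnorm_ge0// mulVf ?gt_eqF// => /(_ (lexx _)).
by rewrite mulrC ler_pdivrMr.
Qed.

Lemma state_norm phi : is_state phi -> forall a, rnorm (phi a) <= rnorm a.
Proof.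
move=> [sphi _ nphi] a; rewrite -[leRHS]mul1r; apply: scalar_bounded => // x x1.
by rewrite -lee_fin -nphi; apply: ereal_sup_ubound; exists x.
Qed.

Lemma state_sup phi : is_state phi -> forall e : R, 0 < e ->
  exists2 a, rnorm a <= 1 & 1 - e < rnorm (phi a).
Proof.
move=> [sphi _ nphi] e e0.
have : ((1 - e)%:E < ereal_sup
    [set (rnorm (phi x))%:E | x in [set x : A | (rnorm x <= 1)%R]])%E.
  by rewrite nphi lte_fin; lra.
by move=> /ereal_sup_gt[_ [x x1 <-]]; rewrite lte_fin => h; exists x.
Qed.

Lemma stateP phi : scalar phi -> (forall x, 0 <= phi (star x ** x)) ->
  (forall a, rnorm (phi a) <= rnorm a) ->
  (forall e : R, 0 < e -> exists2 a, rnorm a <= 1 & 1 - e < rnorm (phi a)) ->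
  is_state phi.
Proof.
move=> sphi pphi nphi hphi; split=> //; apply/le_anti/andP; split.
  apply: ge_ereal_sup => _ [x /= x1 <-]; rewrite lee_fin.
  exact: le_trans (nphi x) x1.
apply/lee_addgt0Pr => e e0; have [a a1 ha] := hphi _ e0.
apply: (@le_trans _ _ ((rnorm (phi a))%:E + e%:E)%E).
  by rewrite -EFinD lee_fin; lra.
by apply: leeD2r; apply: ereal_sup_ubound; exists a.
Qed.

Variables (D : Type) (F : set_system D) (FF : ProperFilter F) (u : D -> A).
Hypothesis hu : approx_unit F u.

(** Cauchy-Schwarz gives [|phi (x u_d)|^2 <= phi (x star x) phi (u_d^2) <= phi (u_d^2)] for [x] in
    the unit ball, and [x] can be chosen with [|phi x|] near 1. *)
Lemma state_unit_sqr phi : is_state phi -> forall e : R, 0 < e ->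
  \forall d \near F, 1 - e < complex.Re (phi (u d ** u d)).
Proof.
move=> hphi e e0; have [us u1 ul ur] := hu.
(* A small [e] keeps [1 - e / 2] positive, so that it can be squared; [(1 - e / 2)^2 >= 1 - e]. *)
wlog e2 : e e0 / e < 1.
  move=> H; have m0 : 0 < Num.min e (1 / 2) by rewrite lt_min e0; lra.
  apply: filterS (H _ m0 _); last by rewrite gt_min; apply/orP; right; lra.
  move=> d; apply: le_lt_trans; have : Num.min e (1 / 2) <= e by rewrite ge_min lexx.
  lra.
have e40 : 0 < e / 4 by lra.
have [x x1 hx] := state_sup hphi e40.
apply: filterS (ur x _ e40) => d hd.
have sphi := state_scalar hphi; have pphi := state_ge0 hphi.
have := positive_cauchy_schwarz sphi pphi (star x) (u d).
rewrite starK us; set v := u d ** u d.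
have v0 : 0 <= phi v by have := pphi (u d); rewrite us.
have -> : rnorm (phi v) = complex.Re (phi v) by rewrite {2}(rnorm_ger0 v0).
have h1 : rnorm (phi (x ** star x)) <= 1.
  by apply: le_trans (state_norm hphi _) _; rewrite rnorm_cstar_r expr_le1 ?rnorm_ge0.
have h2 : 1 - e / 2 < rnorm (phi (x ** u d)).
  have := rnormD (phi (x ** u d)) (phi x - phi (x ** u d)).
  rewrite addrC subrK -scalar_sub// => h3.
  have := state_norm hphi (x - x ** u d); rewrite rnorm_distC; lra.
set r := complex.Re _; set s := rnorm _ in h2 *; set t := rnorm _ in h1 *.
move=> hs; have r0 : 0 <= r by rewrite /r (rnorm_ger0 v0) /= rnorm_ge0.
have : s ^+ 2 <= r by apply: le_trans hs _; rewrite ler_piMl.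
have : (1 - e / 2) ^+ 2 < s ^+ 2 by rewrite ltr_pXn2r// nnegrE; lra.
nra.
Qed.

(** The index [d] must not depend on [y]. With [v = u_d^2] and a later square [w], which may depend
    on [y], [y - y v = (y - y w) + y (w - v)]. The first term is negligible, and Cauchy-Schwarz
    bounds the second by [|y|] times the square root of [phi ((w - v)^2)], where [w v] and [v w] are
    close to [v]. *)
Lemma state_tail phi : is_state phi -> forall e : R, 0 < e ->
  \forall d \near F, forall y,
    rnorm (phi (y - y ** (u d ** u d))) <= e * rnorm y.
Proof.
move=> hphi e e0; have [us u1 ul ur] := hu.
have sphi := state_scalar hphi; have pphi := state_ge0 hphi.
have [vs v1 vl vr] := approx_unit_sqr FF hu.
pose e1 := e ^+ 2 / 16; have e10 : 0 < e1 by rewrite /e1 divr_gt0 ?exprn_gt0.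
apply: filterS (state_unit_sqr hphi e10) => d hd y.
apply/ler_addgt0Pr => n n0; set v := u d ** u d.
have [d' [[]]] := filter_ex (@filterI _ F _ _ _
  (@filterI _ F _ _ _ (vl v _ e10) (vr v _ e10)) (vr y _ n0)).
set w := u d' ** u d' => w1 w2 w3.
have -> : y - y ** v = (y - y ** w) + y ** (w - v) by rewrite amulBr addrA subrK.
rewrite scalar_add//; apply: le_trans (rnormD _ _) _; rewrite addrC lerD//; last first.
  by apply: le_trans (state_norm hphi _) _; rewrite rnorm_distC ltW.
have := positive_cauchy_schwarz sphi pphi (star y) (w - v).
have swv : star (w - v) = w - v by rewrite starB vs vs.
have p0 := pphi (w - v).
rewrite starK swv; rewrite swv in p0.
(* Expanded, the value is at most [2 - 2 Re phi v + 2 e1], hence at most [4 e1], because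
   [Re phi v > 1 - e1]. *)
have q0 : rnorm (phi ((w - v) ** (w - v))) <= e ^+ 2.
  have -> : rnorm (phi ((w - v) ** (w - v))) =
      complex.Re (phi ((w - v) ** (w - v))) by rewrite {2}(rnorm_ger0 p0).
  rewrite amulBl !amulBr !scalar_sub//.
  have nn x : complex.Re (phi x) <= rnorm x /\ - rnorm x <= complex.Re (phi x).
    have := ler_Re_rnorm (phi x); rewrite ler_norml => /andP[].
    have := state_norm hphi x; lra.
  have [a1 _] := nn (w ** w); have [a2 _] := nn (v ** v).
  have [_ a3] := nn (w ** v - v); have [_ a4] := nn (v ** w - v).
  have a5 : rnorm (w ** w) <= 1 by apply: le_trans (rnormMl _ (v1 _)) (v1 _).
  have a6 : rnorm (v ** v) <= 1 by apply: le_trans (rnormMl _ (v1 _)) (v1 _).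
  move: a1 a2 a3 a4 hd; rewrite -/v !scalar_sub//.
  case: (phi (w ** w)) (phi (v ** v)) (phi (w ** v)) (phi (v ** w)) (phi v).
  move=> ? ? [? ?] [? ?] [? ?] [? ?] /=; rewrite /e1 in w1 w2 *.
  have : 0 <= e ^+ 2 by rewrite sqr_ge0.
  lra.
have yy : rnorm (phi (y ** star y)) <= rnorm y ^+ 2.
  by apply: le_trans (state_norm hphi _) _; rewrite rnorm_cstar_r.
move=> hs; rewrite -(ler_pXn2r (n := 2))// ?nnegrE ?rnorm_ge0//; last first.
  by rewrite mulr_ge0 ?rnorm_ge0// ltW.
by apply: le_trans hs _; rewrite exprMn mulrC ler_pM ?rnorm_ge0.
Qed.

End States.

(** * Cohen factorization *)

Lemma dependent_choice_nat (T : Type) (P : nat -> T -> Prop)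
    (Q : nat -> T -> T -> Prop) :
  (exists s, P 0%N s) ->
  (forall n s, P n s -> exists s', P n.+1 s' /\ Q n s s') ->
  exists f : nat -> T, forall n, P n (f n) /\ Q n (f n) (f n.+1).
Proof.
move=> /cid[s0 h0] hs.
have step n (s : {s | P n s}) : {s' : {s' | P n.+1 s'} | Q n (sval s) (sval s')}.
  case: s => s Ps; have /cid[s' [Ps' Q']] := hs n s Ps.
  by exists (exist _ s' Ps').
pose f := fix f n : {s | P n s} :=
  match n with 0 => exist _ s0 h0 | n.+1 => sval (step n (f n)) end.
exists (fun n => sval (f n)) => n; split; first exact: (svalP (f n)).
exact: (svalP (step n (f n))).
Qed.

Lemma subrD2l (V : zmodType) (h a b : V) : (h + a) - (h + b) = a - b.
Proof. by rewrite opprD addrACA subrr add0r. Qed.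

Section Halves.
Variables (R : realType) (V : completeNormedModType R[i]).

Definition half : R[i] := (2^-1)%:C.

Lemma half_double (x : V) : half *: x + half *: x = x.
Proof.
rewrite -scalerDl /half -rmorphD /= -[RHS]scale1r; congr (_ *: _).
by rewrite -[RHS](rmorph1 (real_complex R)); congr _%:C; field.
Qed.

Lemma rnorm_half (x : V) : rnorm (half *: x) = rnorm x / 2.
Proof. by rewrite rnormZr ger0_norm ?invr_ge0// mulrC. Qed.

Lemma rnorm_halfX n (x : V) : rnorm (half ^+ n *: x) = 2^-1 ^+ n * rnorm x.
Proof. by rewrite /half -rmorphXn rnormZr ger0_norm// exprn_ge0// invr_ge0. Qed.

End Halves.
Arguments half {R}.

Section Cohen.
Variables (R : realType) (A : cstarAlgType R).

(* [1/2 + c] is the inverse of [2 - v]. *)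
Lemma neumann_half (v : A) : rnorm v <= 1 ->
  exists c : A, [/\ rnorm c <= 2^-1, c + c = half *: v + v ** c
    & v ** c = c ** v].
Proof.
move=> v1.
(* [(2 - v) (1/2 + c) = 1] reads [2 c = v / 2 + v c]; its iteration contracts with ratio [1/2] and
   stays in [A]. *)
pose c := fix c n := if n is n.+1 then half *: (half *: v + v ** c n) else 0.
have cS n : c n.+1 = half *: (half *: v + v ** c n) by [].
have c1 n : rnorm (c n) <= 2^-1.
  elim: n => [|n IH]; first by rewrite rnorm0 invr_ge0.
  rewrite cS rnorm_half.
  have h1 := rnormD (half *: v) (v ** c n); rewrite rnorm_half in h1.
  have := rnormMl (c n) v1; lra.
have cv n : v ** c n = c n ** v.
  elim: n => [|n IH]; first by rewrite amul0l amul0r.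
  by rewrite cS amulZr amulZl amulDr amulDl amulZr amulZl IH amulA IH.
have cd n : rnorm (c n.+1 - c n) <= 1 * 2^-1 ^+ n.
  elim: n => [|n IH]; first by rewrite subr0 expr0; have := c1 1%N; lra.
  rewrite (cS n.+1) (cS n) -scalerBr subrD2l rnorm_half -amulBr exprS.
  have := rnormMl (c n.+1 - c n) v1; lra.
have q01 : 0 <= (2^-1 : R) < 1 by apply/andP; split; lra.
have [l hl] := geometric_cvg ler01 q01 cd.
have sm (e : R) : 0 < e -> exists n, rnorm (c n - l) < e /\ rnorm (c n.+1 - l) < e.
  move=> e0; have [N _ hN] := geometric_small (1 / (1 - 2^-1)) q01 e0.
  exists N; split; first by apply: le_lt_trans (hl N) (hN _ _) => /=.
  by apply: le_lt_trans (hl N.+1) (hN _ _) => /=.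
exists l; split.
- apply/ler_addgt0Pr => e e0; have [n [hn _]] := sm _ e0.
  have := rnormD (c n) (l - c n); rewrite addrC subrK rnorm_distC.
  have := c1 n; lra.
- suff {1 2}-> : l = half *: (half *: v + v ** l) by rewrite half_double.
  apply: rnorm_eq => e e0; have [n [h1 h2]] := sm _ (divr_gt0 e0 (ltr0Sn _ 1)).
  apply: le_trans (rnorm_dist (c n.+1) _ _) _.
  rewrite (cS n) -scalerBr subrD2l rnorm_half -amulBr -cS rnorm_distC.
  have := rnormMl (c n - l) v1; have := rnorm_ge0 (c n - l); lra.
- apply: rnorm_eq => e e0; have [n [h1 h2]] := sm _ (divr_gt0 e0 (ltr0Sn _ 1)).
  apply: le_trans (rnorm_dist (v ** c n) _ _) _.
  rewrite -amulBr cv -amulBl.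
  have := rnormMl (l - c n) v1; have := rnormMr (c n - l) v1.
  rewrite [rnorm (l - _)]rnorm_distC; lra.
Qed.

Variables (D : Type) (F : set_system D) (FF : ProperFilter F) (v : D -> A).
Hypothesis hv : approx_unit F v.

Definition tail_small (psi : A -> R[i]) : Prop := forall e : R, 0 < e ->
  \forall d \near F, forall y, rnorm (psi (y - y ** v d)) <= e * rnorm y.

(** The new functional is [psi (. (2 - w))]. For [z = y - y v_d] one has [z w = y (w - v_d w)],
    small uniformly on bounded sets of [y] because [w] is fixed and [v_d w] tends to [w]. *)
Lemma tail_small_step (psi : A -> R[i]) (C : R) (w : A) : scalar psi ->
  0 <= C -> (forall x, rnorm (psi x) <= C * rnorm x) -> tail_small psi ->
  tail_small (fun z => psi z + psi (z - z ** w)).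
Proof.
move=> spsi C0 bpsi tpsi e e0; have [vs v1 vl vr] := hv.
have e40 : 0 < e / 4 by lra.
have C10 : 0 < C + 1 by lra.
have e50 : 0 < e / 4 / (C + 1) by rewrite divr_gt0.
apply: filterS2 (tpsi _ e40) (vl w _ e50) => d h1 h2 y.
set z := y - y ** v d; rewrite (scalar_sub spsi z).
have -> : z ** w = y ** (w - v d ** w) by rewrite amulBl amulBr amulA.
have h3 := h1 y; rewrite -/z in h3; set t := y ** (w - _).
have h4 : rnorm (psi t) <= e / 4 * rnorm y.
  apply: le_trans (bpsi _) _; rewrite /t.
  have := rnormM y (w - v d ** w); rewrite [rnorm (w - _)]rnorm_distC => h4.
  apply: le_trans (ler_wpM2l C0 h4) _.
  rewrite mulrCA [leRHS]mulrC ler_wpM2l ?rnorm_ge0//.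
  move: h2; rewrite ltr_pdivlMr//; have := rnorm_ge0 (v d ** w - w); nra.
apply: le_trans (rnormD _ _) _; have := rnormB (psi z) (psi t).
have := rnorm_ge0 y; nra.
Qed.

(* Cohen's factorization. With [t_0 = 1], [t_(n+1) = t_n (1/2 + c)] and
   [t_n = b_n + 2^-n], the functional [psi_n] is [phi (. t_n^-1)]; it stays
   bounded because [phi] is almost invariant under right multiplication by the
   approximate unit. *)
Lemma cohen_bound (phi : A -> R[i]) : scalar phi ->
  (forall x, rnorm (phi x) <= rnorm x) -> tail_small phi ->
  exists b : A, forall a, rnorm (phi a) <= 3 * rnorm (a ** b).
Proof.
move=> sphi bphi tphi; have [vs v1 vl vr] := hv.
(* A pair is [(psi_n, b_n)]. The bound on [psi_n] starts at 1 and gains [2^-n] at step [n], so it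
   stays below 3. *)
pose P n (s : (A -> R[i]) * A) := [/\ scalar s.1,
  forall x, rnorm (s.1 x) <= (3 - 2 * 2^-1 ^+ n) * rnorm x,
  tail_small s.1 & forall a, phi a = s.1 (a ** s.2 + half ^+ n *: a)].
pose Q n (s s' : (A -> R[i]) * A) := rnorm (s'.2 - s.2) <= 2 * 2^-1 ^+ n.
have h0 n : 0 < 2^-1 ^+ n :> R by rewrite exprn_gt0// invr_gt0.
have h1 n : 2^-1 ^+ n <= 1 :> R by rewrite exprn_ile1 ?invr_ge0//; lra.
have [||f hf] := @dependent_choice_nat _ P Q.
- exists (phi, 0); split => //= [x|a]; first by rewrite expr0; have := bphi x; lra.
  by rewrite amul0r add0r expr0 scale1r.
- move=> n [psi b] [/= spsi bpsi tpsi epsi].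
  have h0n := h0 n; have h1n := h1 n; set hn := 2^-1 ^+ n in h0n h1n.
  have [d [d1 d2]] := filter_ex (@filterI _ F _ _ _ (tpsi _ h0n) (vr b _ h0n)).
  have [c [c1 c2 c3]] := neumann_half (v1 d); set w := v d in d1 d2 c2 c3 *.
  have w1 : rnorm w <= 1 by exact: v1.
  (* Says that [x (1/2 + c)] is [x] up to terms in [x w - x]; with [x = b_n] this keeps
     [b_(n+1) - b_n] of order [2^-n]. *)
  have xc x : x ** c = half *: x + half *: (x ** w - x) + (x ** w - x) ** c.
    rewrite -scalerDr [x + _]addrC subrK.
    apply: (@addrI _ (x ** c)); rewrite -amulDr c2 amulDr amulZr amulBl.
    by rewrite [RHS]addrCA -amulA; congr (_ + _); rewrite addrC subrK.
  (* The part in [A] of [(b_n + 2^-n) (1/2 + c)]; its scalar part is [2^-(n+1)]. *)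
  pose bb := half *: b + b ** c + half ^+ n *: c.
  exists ((fun z => psi z + psi (z - z ** w)), bb); split; last first.
    rewrite /Q /= /bb xc; set e := b ** w - b in d2 *.
    have -> : half *: b + (half *: b + half *: e + e ** c) + half ^+ n *: c - b =
        half *: e + e ** c + half ^+ n *: c.
      by rewrite !addrA half_double -!addrA addrC !addrA subrK.
    apply: le_trans (rnormD _ _) _.
    have g1 := rnormD (half *: e) (e ** c); rewrite rnorm_half in g1.
    have := rnormM e c; rewrite rnorm_halfX -/hn.
    have := rnorm_ge0 e; have := rnorm_ge0 c; nra.
  split => /=.
  - move=> k x y; rewrite spsi amulDl amulZl.
    have -> : k *: x + y - (k *: (x ** w) + y ** w) =
        k *: (x - x ** w) + (y - y ** w) by rewrite scalerBr opprD addrACA.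
    by rewrite spsi mulrDr addrACA.
  - move=> x; apply: le_trans (rnormD _ _) _.
    have := bpsi x; have := d1 x; rewrite -/hn exprS -/hn; lra.
  - apply: (@tail_small_step _ 3) => // x; apply: le_trans (bpsi x) _.
    by rewrite ler_wpM2r ?rnorm_ge0//; rewrite -/hn; lra.
  (* This is [x (1/2 + c) (2 - w) = x], which makes the new functional undo the new factor. *)
  - have e2 x : (half *: x + x ** c) + (half *: x + x ** c) =
        x + (half *: x + x ** c) ** w.
      rewrite addrACA half_double -amulDr c2 amulDr amulDl amulZr amulZl.
      by rewrite -amulA c3.
    move=> a; rewrite epsi; set x := a ** b + _.
    have -> : a ** bb + half ^+ n.+1 *: a = half *: x + x ** c.
      rewrite /bb /x !amulDr !amulDl !amulZr !amulZl scalerDr !amulA scalerA.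
      by rewrite -exprS -!addrA; congr (_ + _); rewrite [RHS]addrC -!addrA.
    rewrite /= -(scalar_add spsi). apply: (congr1 psi).
    by rewrite addrA e2 addrK.
have q01 : 0 <= (2^-1 : R) < 1 by apply/andP; split; lra.
have [b hb] := @geometric_cvg _ _ (fun n => (f n).2) 2 _ (ler0n _ 2) q01
  (fun n => (hf n).2).
exists b => a; apply/ler_addgt0Pr => e e0.
(* [15 = 3 (4 + 1)]: [b_n] is within [4 * 2^-n] of [b], the term [2^-n a] adds one more, and [psi_n]
   has norm at most 3. *)
have [n _ hn] := geometric_small (15 * rnorm a) q01 e0.
have [[spsi bpsi _ epsi] _] := hf n; rewrite epsi.
apply: le_trans (bpsi _) _; have /= := hn n (leqnn _).
have := h0 n; have := h1 n; have := hb n; set B := (f n).2; set hn' := 2^-1 ^+ n.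
have := rnormD (a ** B) (half ^+ n *: a); rewrite rnorm_halfX -/hn'.
have := rnormD (a ** b) (a ** (B - b)); rewrite -amulDr addrC subrK.
have := rnormM a (B - b); have := rnorm_ge0 a; have := rnorm_ge0 (B - b).
have := rnorm_ge0 (a ** B + half ^+ n *: a); have := rnorm_ge0 (a ** b).
have -> : 2 / (1 - 2^-1) = 4 :> R by field.
move: (rnorm (a ** B + _)) (rnorm (a ** b)) (rnorm (B - b)) (rnorm a).
move: (rnorm (a ** (B - b))) (rnorm (a ** B)).
move=> W S X Y Z U X0 Y0 Z0 U0 WZ SY XS ZH H1 H0 He.
have UZ : U * Z <= U * (4 * hn') by rewrite ler_wpM2l.
have : (3 - 2 * hn') * X <= 3 * X by rewrite ler_wpM2r//; lra.
by rewrite mulrC in UZ; lra.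
Qed.

End Cohen.

(** * Limits of complex numbers *)

Section ComplexLimits.
Variable R : realType.

Lemma cauchy_complex (T : Type) (F : set_system T) (FF : ProperFilter F)
    (f : T -> R[i]) :
  (forall e : R, 0 < e -> exists x, \forall y \near F, rnorm (f y - f x) < e) ->
  exists l, forall e : R, 0 < e -> \forall x \near F, rnorm (f x - l) < e.
Proof.
move=> h.
have key (g : R[i] -> R) : (forall z w, `|g z - g w| <= rnorm (z - w)) ->
    exists l, forall e : R, 0 < e -> \forall x \near F, `|g (f x) - l| < e.
  move=> hg; have : cvg (g (f x) @[x --> F]).
    apply/cauchy_cvgP/cauchy_exP => e e0.
    have [x hx] := h _ e0; exists (g (f x)).
    apply: filterS hx => y hy; rewrite -ball_normE /= distrC.
    exact: le_lt_trans (hg _ _) hy.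
  move=> /cvg_ex[l /cvgrPdist_lt hl]; exists l => e e0.
  by apply: filterS (hl e e0) => x; rewrite distrC.
have [|a ha] := key (@complex.Re R).
  by move=> z w; have := ler_Re_rnorm (z - w); case: z w => ? ? [? ?].
have [|b hb] := key (@complex.Im R).
  by move=> z w; have := ler_Im_rnorm (z - w); case: z w => ? ? [? ?].
exists (a +i* b) => e e0; have e20 : 0 < e / 2 by rewrite divr_gt0.
apply: filterS2 (ha _ e20) (hb _ e20) => x.
have := rnorm_le_ReIm (f x - (a +i* b)); move: (rnorm _) => N.
by case: (f x) => c d /=; lra.
Qed.

Lemma complex_limit_ge0 (z : R[i]) :
  (forall e : R, 0 < e -> exists2 w, 0 <= w & rnorm (z - w) < e) -> 0 <= z.
Proof.
move=> h; have hI : complex.Im z = 0.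
  apply/eqP; rewrite -normr_eq0 eq_le normr_ge0 andbT.
  apply/ler_addgt0Pr => e e0; have [w w0 hw] := h _ e0.
  have := ler_Im_rnorm (z - w); have := ger0_Im w0.
  move: hw; move: (rnorm _) => N.
  by case: (z) (w) => a b [c d] /= hw ->; rewrite subr0; lra.
have hR : 0 <= complex.Re z.
  apply/ler_addgt0Pr => e e0; have [w w0 hw] := h _ e0.
  have := ler_Re_rnorm (z - w).
  have : 0 <= complex.Re w by move: w0; rewrite lecE => /andP[].
  move: hw; move: (rnorm _) => N; rewrite ler_norml.
  by case: (z) (w) => a b [c d] /= hw c0 /andP[]; lra.
by rewrite [z]complexE hI mulr0 addr0 ler0c.
Qed.

End ComplexLimits.

(** * Strictly continuous extensions of states *)

Section Multipliers.
Variables (R : realType) (A : cstarAlgType R).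
Implicit Types (m n : multiplier A) (a b : A).

Lemma lmult_sub m a b : lmult m (a - b) = lmult m a - lmult m b.
Proof. exact/linear_sub/lmult_linear. Qed.

Lemma lmult_bound m :
  exists2 C : R, 0 <= C & forall a, rnorm (lmult m a) <= C * rnorm a.
Proof.
have [C C0 h] := lmult_bounded m; exists (rnorm C); first exact: rnorm_ge0.
by move=> a; rewrite rnorm_leP rmorphM /= -(rnorm_ger0 C0) -normrE_rnorm.
Qed.

Lemma mult_embedM m a : m ** mult_embed a = mult_embed (lmult m a).
Proof. by apply: multiplier_ext => b /=; rewrite ?lmultM ?rlmult. Qed.

(** [mult_norm] only sees left multiplication; the right one obeys the same bound, since [x = a m]
    gives [|x|^2 = |a (m star x)| <= |a| C |x|]. *)
Lemma rmult_norm m (C : R) : 0 <= C ->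
  (forall a, rnorm (lmult m a) <= C * rnorm a) ->
  forall a, rnorm (rmult m a) <= C * rnorm a.
Proof.
move=> C0 h a; set x := rmult m a.
have : rnorm x ^+ 2 <= rnorm a * (C * rnorm x).
  rewrite -rnorm_cstar_r {1}/x rlmult; apply: le_trans (rnormM _ _) _.
  by rewrite ler_wpM2l ?rnorm_ge0// -[rnorm x]rnorm_star.
rewrite mulrCA mulrA expr2; have [->|x0] := eqVneq (rnorm x) 0.
  by rewrite mulr_ge0 ?rnorm_ge0.
by rewrite ler_pM2r// lt_def x0 rnorm_ge0.
Qed.

Let norm_set m := [set rnorm (lmult m a) | a in [set a : A | rnorm a <= 1]].

Let has_sup_norm_set m : has_sup (norm_set m).
Proof.
split; first by exists (rnorm (lmult m 0)), 0 => //=; rewrite rnorm0 ler01.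
have [C C0 h] := lmult_bound m; exists C => _ [a /= a1 <-].
by apply: le_trans (h a) _; rewrite ler_piMr.
Qed.

Lemma mult_norm_le1 m : mult_norm m <= 1 ->
  forall a, rnorm (lmult m a) <= rnorm a.
Proof.
move=> m1 a; have [->|a0] := eqVneq a 0.
  by rewrite linear_zero ?rnorm0//; exact: lmult_linear.
have na : 0 < rnorm a.
  rewrite lt_def rnorm_ge0 andbT; apply: contra a0 => /eqP.
  by move=> /rnorm0_eq0 ->.
have : rnorm (lmult m ((rnorm a)^-1%:C *: a)) <= 1.
  apply: le_trans m1; apply: sup_upper_bound; first exact: has_sup_norm_set.
  exists ((rnorm a)^-1%:C *: a) => //=.
  by rewrite rnormZr ger0_norm ?invr_ge0 ?rnorm_ge0// mulVf ?gt_eqF.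
rewrite linear_scale; last exact: lmult_linear.
by rewrite rnormZr ger0_norm ?invr_ge0 ?rnorm_ge0// mulrC ler_pdivrMr// mul1r.
Qed.

Lemma mult_norm_le m (C : R) : 0 <= C ->
  (forall a, rnorm (lmult m a) <= C * rnorm a) -> mult_norm m <= C.
Proof.
move=> C0 h; apply: ge_sup; first by case: (has_sup_norm_set m).
by move=> _ [a /= a1 <-]; apply: le_trans (h a) _; rewrite ler_piMr.
Qed.

Lemma mult_norm_embed a : mult_norm (mult_embed a) <= rnorm a.
Proof. by apply: mult_norm_le; [exact: rnorm_ge0|move=> b; exact: rnormM]. Qed.

Lemma strict_cvg (T : Type) (G : set_system T) (FG : Filter G)
    (f : T -> multiplier A) m :
  (forall b (e : R), 0 < e ->
    \forall t \near G, rnorm (lmult (f t) b - lmult m b) < e) ->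
  (forall b (e : R), 0 < e ->
    \forall t \near G, rnorm (rmult (f t) b - rmult m b) < e) ->
  f @ G --> m.
Proof.
move=> hl hr.
have cl : (fun t => lmult (f t) : {ptws A -> A}) @ G --> (lmult m : {ptws A -> A}).
  by apply/pointwise_cvgP => b; apply/cvg_rnormP; exact: hl.
have cr : (fun t => rmult (f t) : {ptws A -> A}) @ G --> (rmult m : {ptws A -> A}).
  by apply/pointwise_cvgP => b; apply/cvg_rnormP; exact: hr.
have cp := cvg_pair cl cr.
move=> U [B [[C Cop <-] Cm] CU]; apply: filterS CU _.
have /cp : nbhs (mult_pair m) C by apply: open_nbhs_nbhs.
exact.
Qed.

Lemma strict_near m b (e : R) : 0 < e ->
  (\forall n \near m, rnorm (lmult n b - lmult m b) < e) /\
  (\forall n \near m, rnorm (rmult n b - rmult m b) < e).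
Proof.
move=> e0.
have cp : (mult_pair n) @[n --> m] --> mult_pair m by exact: initial_continuous.
have cl : (mult_pair n).1 @[n --> m] --> (lmult m : {ptws A -> A}).
  exact: (cvg_comp _ _ cp cvg_fst).
have cr : (mult_pair n).2 @[n --> m] --> (rmult m : {ptws A -> A}).
  exact: (cvg_comp _ _ cp cvg_snd).
split.
- have h : lmult n b @[n --> m] --> lmult m b.
    exact: ((pointwise_cvgP _ (fmap_filter _ (nbhs_filter m))).1 cl b).
  exact: ((cvg_rnormP (nbhs_filter m) _ _).1 h e e0).
- have h : rmult n b @[n --> m] --> rmult m b.
    exact: ((pointwise_cvgP _ (fmap_filter _ (nbhs_filter m))).1 cr b).
  exact: ((cvg_rnormP (nbhs_filter m) _ _).1 h e e0).
Qed.

End Multipliers.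

Section StateExtension.
Variables (R : realType) (A : cstarAlgType R).
Implicit Types (phi : A -> R[i]) (m n : multiplier A).

Lemma lmult_mul m n a : lmult (m ** n) a = lmult m (lmult n a).
Proof. by []. Qed.

Lemma lmult_unit_near (D : Type) (F : set_system D) (FF : Filter F) (v : D -> A)
    (hv : approx_unit F v) m b (e : R) : 0 < e ->
  \forall d \near F, rnorm (lmult m (v d ** b) - lmult m b) < e.
Proof.
move=> e0; have [C C0 hC] := lmult_bound m; have [vs v1 vl vr] := hv.
have e10 : 0 < e / (C + 1) by rewrite divr_gt0// ltr_pwDr.
apply: filterS (vl b _ e10) => d; rewrite ltr_pdivlMr ?ltr_pwDr// => h.
rewrite -lmult_sub; apply: le_lt_trans (hC _) _.
by have := rnorm_ge0 (v d ** b - b); nra.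
Qed.

Lemma strict_mul_unit (D : Type) (F : set_system D) (FF : Filter F)
    (v : D -> A) (hv : approx_unit F v) m :
  m ** mult_embed (v d) @[d --> F] --> m.
Proof.
have [vs v1 vl vr] := hv.
apply: strict_cvg => b e e0; first exact: lmult_unit_near.
exact: vr.
Qed.

Section Construction.
Variables (D : Type) (F : set_system D) (FF : ProperFilter F) (v : D -> A).
Hypothesis hv : approx_unit F v.
Variables (phi : A -> R[i]) (b : A).
Hypothesis hphi : is_state phi.
Hypothesis hb : forall a, rnorm (phi a) <= 3 * rnorm (a ** b).

Let sphi := state_scalar hphi.

(** [hb] bounds the difference of two values by [3 |m (v_d b) - m (v_d0 b)|], and [m (v_d b)] tends
    to [m b]. *)
Let limit_ex m : exists z, forall e : R, 0 < e ->
  \forall d \near F, rnorm (phi (lmult m (v d)) - z) < e.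
Proof.
apply: cauchy_complex => e e0; have e60 : 0 < e / 6 by lra.
have hm := lmult_unit_near FF hv m b e60.
have [d0 hd0] := filter_ex hm; exists d0; apply: filterS hm => d hd.
rewrite -scalar_sub//; apply: le_lt_trans (hb _) _.
rewrite amulBl -!lmultM.
have := rnorm_dist (lmult m b) (lmult m (v d ** b)) (lmult m (v d0 ** b)).
rewrite [rnorm (lmult m b - _)]rnorm_distC; lra.
Qed.

Let Phi m := projT1 (cid (limit_ex m)).

Let PhiP m (e : R) : 0 < e ->
  \forall d \near F, rnorm (phi (lmult m (v d)) - Phi m) < e.
Proof. exact: (projT2 (cid (limit_ex m))). Qed.

Let Phi_eq m z : (forall e : R, 0 < e ->
  \forall d \near F, rnorm (phi (lmult m (v d)) - z) <= e) -> Phi m = z.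
Proof.
move=> h; apply: rnorm_eq => e e0; have e20 : 0 < e / 2 by lra.
have [d [h1 h2]] := filter_ex (@filterI _ F _ _ _ (PhiP m e20) (h _ e20)).
have := rnorm_dist (phi (lmult m (v d))) (Phi m) z.
rewrite [rnorm (Phi m - phi _)]rnorm_distC; lra.
Qed.

Let Phi_scalar : scalar Phi.
Proof.
move=> c m n; apply: Phi_eq => e e0.
have c10 : 0 < rnorm c + 1 by rewrite ltr_pwDr ?rnorm_ge0.
have e10 : 0 < e / (rnorm c + 1) / 2 by rewrite !divr_gt0.
have e20 : 0 < e / 2 by lra.
apply: filterS2 (PhiP m e10) (PhiP n e20) => d.
rewrite ltr_pdivlMr// ltr_pdivlMr// => h1 h2.
rewrite /= sphi opprD addrACA -mulrBr; apply: le_trans (rnormD _ _) _.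
rewrite rnormCM; have := rnorm_ge0 (phi (lmult m (v d)) - Phi m).
have := rnorm_ge0 c; nra.
Qed.

Let Phi_embed a : Phi (mult_embed a) = phi a.
Proof.
have [vs v1 vl vr] := hv.
apply: Phi_eq => e e0; apply: filterS (vr a _ e0) => d h /=.
by rewrite -scalar_sub//; apply: le_trans (state_norm hphi _) (ltW _).
Qed.

(** The single strict seminorm [|m b|] dominates [Phi], whence strict continuity without restriction
    to bounded sets. *)
Let Phi_bound m : rnorm (Phi m) <= 3 * rnorm (lmult m b).
Proof.
apply/ler_addgt0Pr => e e0; have e60 : 0 < e / 6 by lra.
have [d [h1 h2]] := filter_ex (@filterI _ F _ _ _ (PhiP m e60)
  (lmult_unit_near FF hv m b e60)).
have := hb (lmult m (v d)); rewrite -lmultM.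
have := rnormD (lmult m b) (lmult m (v d ** b) - lmult m b).
have := rnormB (phi (lmult m (v d))) (phi (lmult m (v d)) - Phi m).
rewrite opprB addrCA subrr addr0 [_ + (_ - _)]addrCA subrr addr0; lra.
Qed.

Let Phi_continuous : continuous (Phi : multiplier A -> R[i]^o).
Proof.
move=> m; apply: (@cvgrPdist_lt _ R[i]^o _ _ (nbhs_filter m) _ _).2 => e e0.
have [re0 ee] : 0 < complex.Re e /\ e = (complex.Re e)%:C.
  by move: e0; rewrite ltcE /= => /andP[/eqP ei er]; rewrite [e]complexE ei
    mulr0 addr0.
have e40 : 0 < complex.Re e / 4 by lra.
have [hm _] := strict_near m b e40.
apply: (@filterS _ _ (nbhs_filter m) _ _ _ hm) => n hn.
rewrite -(scalar_sub Phi_scalar) ee -rnorm_ltP.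
apply: le_lt_trans (Phi_bound _) _ => /=.
have -> : lmult m b + - 1 *: lmult n b = lmult m b - lmult n b by rewrite scaleN1r.
rewrite rnorm_distC; lra.
Qed.

(** With [p = star m ** m], the compression [v_d p v_d = star (m v_d) ** (m v_d)] lies in [A], where
    [phi] is positive, and approximates [p] in the seminorm at [b]. *)
Let Phi_positive m : 0 <= Phi (star m ** m).
Proof.
have [vs v1 vl vr] := hv.
apply: complex_limit_ge0 => e e0; have e60 : 0 < e / 6 by lra.
set p := star m ** m.
have [d [h1 h2]] := filter_ex (@filterI _ F _ _ _ (vl (lmult p b) _ e60)
  (lmult_unit_near FF hv p b e60)).
exists (phi (star (lmult m (v d)) ** lmult m (v d))); first exact: state_ge0.
have -> : star (lmult m (v d)) ** lmult m (v d) = v d ** lmult p (v d).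
  by rewrite /p lmult_mul -(rlmult (star m)) /= vs.
rewrite -Phi_embed -(scalar_sub Phi_scalar); apply: le_lt_trans (Phi_bound _) _.
(* [q - v q v = (q - v q) + v (q - q v)], evaluated at [b]. *)
have E q : lmult (q - mult_embed (v d ** lmult q (v d))) b =
   (lmult q b - v d ** lmult q b) + v d ** (lmult q b - lmult q (v d ** b)).
  by rewrite amulBr addrA subrK /= scaleN1r lmultM amulA.
rewrite E.
have := rnormD (lmult p b - v d ** lmult p b)
  (v d ** (lmult p b - lmult p (v d ** b))).
have := rnormMl (lmult p b - lmult p (v d ** b)) (v1 d).
rewrite [rnorm (lmult p b - lmult _ _)]rnorm_distC.
rewrite [rnorm (lmult p b - _ ** _)]rnorm_distC; lra.
Qed.

Lemma state_extension_construct : exists Psi : multiplier A -> R[i],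
  [/\ is_state_for (@mult_norm R A) Psi,
      continuous (Psi : multiplier A -> R[i]^o)
    & forall a, Psi (mult_embed a) = phi a].
Proof.
exists Phi; split=> //; split=> //.
have [vs v1 vl vr] := hv.
apply/le_anti/andP; split.
  apply: ge_ereal_sup => _ [m /= m1 <-]; rewrite lee_fin.
  apply/ler_addgt0Pr => e e0; have [d hd] := filter_ex (PhiP m e0).
  have := rnormB (phi (lmult m (v d))) (phi (lmult m (v d)) - Phi m).
  rewrite opprB [_ + (_ - _)]addrCA subrr addr0.
  have := state_norm hphi (lmult m (v d)).
  have := mult_norm_le1 m1 (v d); have := v1 d; lra.
apply/lee_addgt0Pr => e e0; have [a a1 ha] := state_sup hphi e0.
apply: (@le_trans _ _ ((rnorm (phi a))%:E + e%:E)%E).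
  by rewrite -EFinD lee_fin; lra.
apply: leeD2r; apply: ereal_sup_ubound; exists (mult_embed a) => /=.
  exact: le_trans (mult_norm_embed a) a1.
by rewrite Phi_embed.
Qed.

End Construction.

Variables (D : Type) (F : set_system D) (FF : ProperFilter F) (u : D -> A).
Hypothesis hu : approx_unit F u.

Lemma state_extensionP phi : is_state phi ->
  [/\ is_state_for (@mult_norm R A) (state_extension phi),
      continuous (state_extension phi : multiplier A -> R[i]^o)
    & forall a, state_extension phi (mult_embed a) = phi a].
Proof.
move=> hphi; have hv := approx_unit_sqr FF hu.
have [b hb] := cohen_bound FF hv (state_scalar hphi) (state_norm hphi)
  (state_tail FF hu hphi).
by have := xgetPex (fun=> 0) (state_extension_construct FF hv hphi hb).
Qed.

Lemma state_extension_cvg phi (T : Type) (G : set_system T) (FG : Filter G)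
    (f : T -> multiplier A) m : is_state phi -> f @ G --> m ->
  forall e : R, 0 < e ->
  \forall t \near G, rnorm (state_extension phi (f t) - state_extension phi m) < e.
Proof.
move=> /state_extensionP[_ cphi _] fm e e0.
have /cvgrPdist_lt /(_ e%:C) := cvg_comp _ _ fm (cphi m).
rewrite ltcR => /(_ e0); apply: filterS => t.
by rewrite rnorm_distC rnorm_ltP.
Qed.

(** Pins down whichever extension [xget] has picked: [m u_d] tends to [m] strictly. Comparisons of
    extensions of different states go through this limit. *)
Lemma state_extension_unit phi m : is_state phi -> forall e : R, 0 < e ->
  \forall d \near F, rnorm (phi (lmult m (u d)) - state_extension phi m) < e.
Proof.
move=> hphi e e0; have [_ _ ephi] := state_extensionP hphi.
have := state_extension_cvg FF hphi (@strict_mul_unit _ _ FF _ hu m) e0.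
by apply: filterS => d; rewrite mult_embedM ephi.
Qed.

Lemma state_extension_bound phi m (C : R) : is_state phi -> 0 <= C ->
  (forall a, rnorm (lmult m a) <= C * rnorm a) ->
  rnorm (state_extension phi m) <= C.
Proof.
move=> hphi C0 hC; have [us u1 ul ur] := hu.
apply/ler_addgt0Pr => e e0.
have [d hd] := filter_ex (state_extension_unit m hphi e0).
have := rnormB (phi (lmult m (u d))) (phi (lmult m (u d)) - state_extension phi m).
rewrite opprB [_ + (_ - _)]addrCA subrr addr0.
have := state_norm hphi (lmult m (u d)); have := hC (u d).
have := u1 d; have := rnorm_ge0 (u d); nra.
Qed.

(** Cauchy-Schwarz for [1] and [a] gives [|phi a|^2 <= Phi 1 * phi (star a a) <= Phi 1] on the unit
    ball, where [|phi a|] comes close to 1. *)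
Lemma state_extension_one phi : is_state phi ->
  state_extension phi (mult_one A) = 1.
Proof.
move=> hphi; have [[sPhi pPhi _] _ ePhi] := state_extensionP hphi.
have s1 : star (mult_one A) = mult_one A.
  by apply: multiplier_ext => a /=; rewrite starK.
have m11 : mult_one A ** mult_one A = mult_one A by apply: multiplier_ext.
have p1 : 0 <= state_extension phi (mult_one A).
  by have := pPhi (mult_one A); rewrite s1 m11.
have n1 : rnorm (state_extension phi (mult_one A)) <= 1.
  by apply: state_extension_bound => // a; rewrite mul1r.
rewrite (rnorm_ger0 p1) -[RHS](rmorph1 (real_complex R)); congr _%:C.
apply/le_anti; rewrite n1 /=.
apply/ler_addgt0Pr => e e0; have e20 : 0 < e / 2 by lra.
have [a a1 ha] := state_sup hphi e20.
have := positive_cauchy_schwarz sPhi pPhi (mult_one A) (mult_embed a).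
rewrite s1.
have -> : mult_one A ** mult_embed a = mult_embed a by rewrite mult_embedM.
rewrite m11.
have -> : star (mult_embed a) ** mult_embed a = mult_embed (star a ** a).
  by rewrite mult_embedM /= starM starK.
rewrite !ePhi; have := state_norm hphi (star a ** a); rewrite rnorm_cstar.
have := rnorm_ge0 a; have := rnorm_ge0 (phi a).
have := rnorm_ge0 (phi (star a ** a)).
move: n1 ha (rnorm_ge0 (state_extension phi (mult_one A))).
move: (rnorm (phi (star a ** a))) (rnorm (phi a)) (rnorm a) a1 => x y z z1.
move: (rnorm _) => t t1 hy t0 x0 y0 z0 xz.
have : z ^+ 2 <= 1 by rewrite expr_le1.
have : t * x <= t * 1 by rewrite ler_wpM2l//; nra.
nra.
Qed.

Lemma state_unit phi : is_state phi -> forall e : R, 0 < e ->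
  \forall d \near F, rnorm (phi (u d) - 1) < e.
Proof.
move=> hphi e e0; have := state_extension_unit (mult_one A) hphi e0.
by rewrite state_extension_one.
Qed.

End StateExtension.

(** * Strictly continuous extensions of *-homomorphisms *)

Section Contractivity.
Variables (R : realType) (A B : cstarAlgType R).

(** [t] is [1 - sqrt (1 - x^2)], the fixpoint of [t |-> (x^2 + t^2) / 2]. This map preserves the
    ball of radius [q] and is [q]-Lipschitz there; the iterates started at 0 are self-adjoint and
    commute with [x]. *)
Lemma sqrt_series (x : A) (q : R) : star x = x -> rnorm x <= q -> q < 1 ->
  exists t : A, [/\ star t = t, x ** t = t ** x & t + t = x ** x + t ** t].
Proof.
move=> xs xq q1; have q0 : 0 <= q by apply: le_trans xq; exact: rnorm_ge0.
pose c := fix c n : A := if n is n.+1 then half *: (x ** x + c n ** c n) else 0.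
have cS n : c n.+1 = half *: (x ** x + c n ** c n) by [].
have sq (y : A) : rnorm y <= q -> rnorm (y ** y) <= q * q.
  by move=> yq; apply: le_trans (rnormM _ _) _; rewrite ler_pM ?rnorm_ge0.
have c1 n : rnorm (c n) <= q.
  elim: n => [|n IH]; first by rewrite rnorm0.
  rewrite cS rnorm_half; have h1 := rnormD (x ** x) (c n ** c n).
  by have := sq _ xq; have := sq _ IH; nra.
have cs n : star (c n) = c n.
  elim: n => [|n IH]; first exact: star0.
  have hh : Num.conj (half : R[i]) = half by rewrite /half /Num.conj /= oppr0.
  by rewrite cS starZ hh starD !starM xs IH.
have cv n : x ** c n = c n ** x.
  elim: n => [|n IH]; first by rewrite amul0l amul0r.
  by rewrite cS amulZr amulZl amulDr amulDl !amulA IH -!amulA IH.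
have lip (y z : A) : rnorm y <= q -> rnorm z <= q ->
    rnorm (y ** y - z ** z) <= 2 * q * rnorm (y - z).
  move=> yq zq; have -> : y ** y - z ** z = y ** (y - z) + (y - z) ** z.
    by rewrite amulBr amulBl addrA subrK.
  apply: le_trans (rnormD _ _) _.
  have := rnormM y (y - z); have := rnormM (y - z) z.
  by have := rnorm_ge0 (y - z); nra.
have cd n : rnorm (c n.+1 - c n) <= 1 * q ^+ n.
  elim: n => [|n IH]; first by rewrite subr0 expr0; have := c1 1%N; lra.
  rewrite (cS n.+1) (cS n) -scalerBr subrD2l rnorm_half exprS.
  have := lip _ _ (c1 n.+1) (c1 n); nra.
have q01 : 0 <= q < 1 by rewrite q0.
have [l hl] := geometric_cvg ler01 q01 cd.
have sm (e : R) : 0 < e -> exists n, rnorm (l - c n) < e /\ rnorm (l - c n.+1) < e.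
  move=> e0; have [N _ hN] := geometric_small (1 / (1 - q)) q01 e0.
  exists N; rewrite !(rnorm_distC l).
  split; first by apply: le_lt_trans (hl N) (hN _ _) => /=.
  by apply: le_lt_trans (hl N.+1) (hN _ _) => /=.
have l1 : rnorm l <= q.
  apply/ler_addgt0Pr => e e0; have [n [hn _]] := sm _ e0.
  by have := rnormD (c n) (l - c n); rewrite addrC subrK; have := c1 n; lra.
exists l; split.
- apply: rnorm_eq => e e0; have [n [h1 h2]] := sm _ (divr_gt0 e0 (ltr0Sn _ 1)).
  apply: le_trans (rnorm_dist (c n) _ _) _.
  rewrite -{1}(cs n) -starB rnorm_star (rnorm_distC (c n)); lra.
- apply: rnorm_eq => e e0; have [n [h1 h2]] := sm _ (divr_gt0 e0 (ltr0Sn _ 1)).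
  apply: le_trans (rnorm_dist (x ** c n) _ _) _.
  rewrite -amulBr cv -amulBl; have x1 : rnorm x <= 1 by lra.
  have := rnormMl (l - c n) x1; have := rnormMr (c n - l) x1.
  rewrite [rnorm (c n - l)]rnorm_distC; lra.
- suff {1 2}-> : l = half *: (x ** x + l ** l) by rewrite half_double.
  apply: rnorm_eq => e e0; have [n [h1 h2]] := sm _ (divr_gt0 e0 (ltr0Sn _ 1)).
  apply: le_trans (rnorm_dist (c n.+1) _ _) _.
  rewrite (cS n) -scalerBr subrD2l rnorm_half -cS.
  have := lip _ _ (c1 n) l1; rewrite (rnorm_distC (c n) l).
  by have := rnorm_ge0 (l - c n); nra.
Qed.

Lemma unitary_isometry (w : multiplier B) b :
  star w ** w = mult_one B -> rnorm (lmult w b) = rnorm b.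
Proof.
move=> ww; apply/eqP.
rewrite -(eqrXn2 (n := 2)) ?rnorm_ge0// -!rnorm_cstar.
have -> : star (lmult w b) = rmult (star w) (star b) by rewrite /= starK.
by rewrite rlmult -lmult_mul ww.
Qed.

Variable f : A -> multiplier B.
Hypothesis hf : star_hom f.

(* A self-adjoint [x] with [|x| < 1] has [x^2 + (1 - t)^2 = 1] with [t] in [A]
   self-adjoint and commuting with [x]; so [f x + i (1 - f t)] is unitary, and
   [f x] is the mean of it and its adjoint. *)
Lemma star_hom_ball (x : A) b : star x = x -> rnorm x < 1 ->
  rnorm (lmult (f x) b) <= rnorm b.
Proof.
case: hf => lf mf sf xs x1; have [t [ts xt tt]] := sqrt_series xs (lexx _) x1.
set y := f x; set s := mult_one B - f t.
have ys : star y = y by rewrite /y -sf xs.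
have ss : star s = s.
  rewrite /s starD starN -sf ts; congr (_ - _).
  by apply: multiplier_ext => a /=; rewrite starK.
have m1l (z : multiplier B) : mult_one B ** z = z by apply: multiplier_ext.
have m1r (z : multiplier B) : z ** mult_one B = z by apply: multiplier_ext.
have sy : s ** y = y ** s.
  by rewrite /s amulDl amulDr amulNl amulNr m1l m1r /y -!mf xt.
have ys1 : y ** y + s ** s = mult_one B.
  have tt' : f t + f t = y ** y + f (t ** t).
    by rewrite /y -mf -!(linear_add lf) tt.
  have -> : s ** s = mult_one B - f t - (f t - f (t ** t)).
    by rewrite {1}/s amulDl amulNl m1l /s amulDr amulNr m1r -mf.
  have -> : mult_one B - f t - (f t - f (t ** t)) = mult_one B - y ** y.
    by rewrite -addrA -opprD addrA tt' addrK.
  by rewrite addrC subrK.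
have ii : 'i%C * 'i%C = -1 :> R[i] by rewrite -expr2 sqr_i.
have cji : Num.conj 'i%C = - 'i%C :> R[i].
  by apply/eqP; rewrite /Num.conj eq_complex /= oppr0 !eqxx.
have us : star (y + 'i%C *: s) = y - 'i%C *: s.
  by rewrite starD starZ ys ss cji scaleNr.
have us' : star (y - 'i%C *: s) = y + 'i%C *: s by rewrite -us starK.
have u1 : star (y + 'i%C *: s) ** (y + 'i%C *: s) = mult_one B.
  rewrite us amulDl !amulDr amulNl amulNl !amulZl !amulZr scalerA ii.
  by rewrite scaleN1r opprK sy addrA addrK ys1.
have u2 : star (y - 'i%C *: s) ** (y - 'i%C *: s) = mult_one B.
  rewrite us' amulDl !amulDr !amulNr !amulZl !amulZr scalerA ii.
  by rewrite scaleN1r opprK sy addrA subrK ys1.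
have h1 := unitary_isometry b u1; have h2 := unitary_isometry b u2.
have e12 : lmult (y + 'i%C *: s) b + lmult (y - 'i%C *: s) b =
    lmult y b + lmult y b.
  rewrite -[LHS]/(lmult ((y + 'i%C *: s) + (y - 'i%C *: s)) b).
  by rewrite addrACA subrr addr0.
have := rnormD (lmult (y + 'i%C *: s) b) (lmult (y - 'i%C *: s) b).
rewrite e12 h1 h2; have -> : lmult y b + lmult y b = 2%:C *: lmult y b.
  by rewrite rmorph_nat scaler_nat mulr2n.
rewrite rnormZr normr_nat; lra.
Qed.

(** The C*-identity [|f a b|^2 = |star b (f (star a a) b)|] reduces to self-adjoint arguments, and
    scaling reduces those to the open unit ball. *)
Lemma star_hom_contractive (a : A) b :
  rnorm (lmult (f a) b) <= rnorm a * rnorm b.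
Proof.
case: (hf) => lf mf sf.
have sa (x : A) : star x = x -> rnorm (lmult (f x) b) <= rnorm x * rnorm b.
  move=> xs; apply/ler_addgt0Pr => e e0.
  have b1 : 0 < rnorm b + 1 by rewrite ltr_pwDr ?rnorm_ge0.
  (* Strictly larger than [|x|], to land in the open ball; the excess costs at most [e] after
     multiplication by [|b|]. *)
  pose K := rnorm x + e / (rnorm b + 1).
  have eb0 : 0 < e / (rnorm b + 1) by rewrite divr_gt0.
  have xK : rnorm x < K by rewrite ltrDl.
  have K0 : 0 < K by apply: le_lt_trans xK; exact: rnorm_ge0.
  have := @star_hom_ball (K^-1%:C *: x) b.
  rewrite starZ xs rnormZr ger0_norm ?invr_ge0 ?(ltW K0)// mulrC ltr_pdivrMr//.
  rewrite mul1r (linear_scale lf) /= rnormZr ger0_norm ?invr_ge0 ?(ltW K0)//.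
  have -> : Num.conj (K^-1%:C : R[i]) = K^-1%:C.
    by apply/eqP; rewrite /Num.conj eq_complex /= oppr0 !eqxx.
  move=> /(_ erefl xK); rewrite mulrC ler_pdivrMr// => h.
  apply: le_trans h _; rewrite /K mulrDr [rnorm x * _]mulrC lerD2l.
  rewrite mulrA ler_pdivrMr// [e * _]mulrC ler_wpM2r ?(ltW e0)//; lra.
rewrite -(ler_pXn2r (n := 2)) ?nnegrE ?mulr_ge0 ?rnorm_ge0//.
rewrite -rnorm_cstar.
have -> : star (lmult (f a) b) = rmult (f (star a)) (star b).
  by rewrite sf /= starK.
rewrite rlmult -lmult_mul -mf; apply: le_trans (rnormM _ _) _.
rewrite rnorm_star; have := sa (star a ** a); rewrite starM starK rnorm_cstar.
by move=> /(_ erefl); have := rnorm_ge0 b; nra.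
Qed.

End Contractivity.

(** If the left parts agree and [y] is the difference of the right parts at [a], then
    [y ** star y = a ** 0], so [y = 0]. Identities between multipliers can thus be checked on the
    left. *)
Lemma mult_ext_l (R : realType) (A : cstarAlgType R) (m n : multiplier A) :
  lmult m =1 lmult n -> m = n.
Proof.
move=> h; apply: multiplier_ext => // a; apply/eqP; rewrite -subr_eq0.
apply/eqP/rnorm0_eq0/eqP; rewrite -(sqrf_eq0 (rnorm _)) -rnorm_cstar_r.
by rewrite {1}amulBl !rlmult h subrr rnorm0.
Qed.

Section StrictExtension.
Variables (R : realType) (A B : cstarAlgType R) (f : A -> multiplier B).
Hypothesis hf : star_hom f.
Variables (D : Type) (F : set_system D) (FF : ProperFilter F) (u : D -> A).
Hypothesis hu : approx_unit F u.
Hypothesis fu : forall b (e : R), 0 < e ->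
  \forall d \near F, rnorm (lmult (f (u d)) b - b) < e.
Implicit Types (m n : multiplier A).

Let lf : linear f. Proof. by case: hf. Qed.
Let mf x y : f (x ** y) = f x ** f y. Proof. by case: hf. Qed.
Let sf x : f (star x) = star (f x). Proof. by case: hf. Qed.

Let f_dist x y b :
  rnorm (lmult (f x) b - lmult (f y) b) <= rnorm (x - y) * rnorm b.
Proof.
have -> : lmult (f x) b - lmult (f y) b = lmult (f (x - y)) b.
  by rewrite (linear_sub lf) /= scaleN1r.
exact: star_hom_contractive.
Qed.

(** The vectors [f a b] are dense, as [f (u_d) b] tends to [b], and Lipschitz maps are determined on
    a dense set. *)
Lemma dense_eq (h k : B -> B) (C : R) : 0 <= C ->
  (forall x y, rnorm (h x - h y) <= C * rnorm (x - y)) ->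
  (forall x y, rnorm (k x - k y) <= C * rnorm (x - y)) ->
  (forall a b, h (lmult (f a) b) = k (lmult (f a) b)) -> h =1 k.
Proof.
move=> C0 hh hk hhk b; apply: rnorm_eq => e e0.
have C1 : 0 < C + 1 by rewrite ltr_pwDr.
have e10 : 0 < e / (C + 1) / 2 by rewrite !divr_gt0.
have [d] := filter_ex (fu b e10); rewrite ltr_pdivlMr// ltr_pdivlMr// => hd.
set x := lmult (f (u d)) b in hd.
apply: le_trans (rnorm_dist (h x) _ _) _.
have hx : h x = k x := hhk _ _.
have := hh b x; have := hk x b; rewrite -hx (rnorm_distC b x).
by have := rnorm_ge0 (x - b); nra.
Qed.

(** Replace [b] by [f (u_d0) b] at a small cost: [f (m u_d) (f (u_d0) b) = f (m (u_d u_d0)) b] tends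
    to [f (m u_d0) b], because [f] is contractive. *)
Let limit_ex m b : exists y, forall e : R, 0 < e ->
  \forall d \near F, rnorm (lmult (f (lmult m (u d))) b - y) < e.
Proof.
have [us u1 ul ur] := hu; have [C C0 hC] := lmult_bound m.
apply: cauchy_rnorm => e e0.
have C1 : 0 < C + 1 by rewrite ltr_pwDr.
have e10 : 0 < e / (C + 1) / 2 by rewrite !divr_gt0.
have b1 : 0 < rnorm b + 1 by rewrite ltr_pwDr ?rnorm_ge0.
have e20 : 0 < e / (rnorm b + 1) / 2 by rewrite !divr_gt0.
have [d0] := filter_ex (fu b e10); rewrite ltr_pdivlMr// ltr_pdivlMr// => hd0.
exists d0; apply: filterS (lmult_unit_near FF hu m (u d0) e20) => d.
rewrite ltr_pdivlMr// ltr_pdivlMr// => hd.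
set y := lmult (f (u d0)) b in hd0.
apply: le_lt_trans (rnorm_dist (lmult (f (lmult m (u d))) y) _ _) _.
rewrite -lmult_sub.
have h1 := star_hom_contractive hf (lmult m (u d)) (b - y).
have h2 := hC (u d); have h3 := u1 d; have h4 := f_dist (lmult m (u d ** u d0))
  (lmult m (u d0)) b.
move: h4; rewrite lmultM mf lmult_mul -/y -lmultM => h4.
move: hd0 h1; rewrite (rnorm_distC y) => hd0 h1.
have := rnorm_ge0 (b - y); have := rnorm_ge0 b.
have := rnorm_ge0 (lmult m (u d ** u d0) - lmult m (u d0)).
have : rnorm (lmult m (u d)) * rnorm (b - y) <= C * rnorm (b - y).
  by rewrite ler_wpM2r ?rnorm_ge0//; have := rnorm_ge0 (u d); nra.
nra.
Qed.

Definition left_ext m b : B := projT1 (cid (limit_ex m b)).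

Let left_extP m b (e : R) : 0 < e ->
  \forall d \near F, rnorm (lmult (f (lmult m (u d))) b - left_ext m b) < e.
Proof. exact: (projT2 (cid (limit_ex m b))). Qed.

Let left_ext_eq m b y : (forall e : R, 0 < e ->
  \forall d \near F, rnorm (lmult (f (lmult m (u d))) b - y) <= e) ->
  left_ext m b = y.
Proof.
move=> h; apply: rnorm_eq => e e0; have e20 : 0 < e / 2 by lra.
have [d [h1 h2]] := filter_ex (@filterI _ F _ _ _ (left_extP m b e20) (h _ e20)).
have := rnorm_dist (lmult (f (lmult m (u d))) b) (left_ext m b) y.
rewrite [rnorm (left_ext m b - lmult _ _)]rnorm_distC; lra.
Qed.

Let left_ext_linear m : linear (left_ext m).
Proof.
move=> c a b; apply: left_ext_eq => e e0.
have c10 : 0 < rnorm c + 1 by rewrite ltr_pwDr ?rnorm_ge0.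
have e10 : 0 < e / (rnorm c + 1) / 2 by rewrite !divr_gt0.
have e20 : 0 < e / 2 by lra.
apply: filterS2 (left_extP m a e10) (left_extP m b e20) => d.
rewrite ltr_pdivlMr// ltr_pdivlMr// => h1 h2.
rewrite lmult_linear opprD addrACA -scalerBr; apply: le_trans (rnormD _ _) _.
rewrite rnormZ; have := rnorm_ge0 (lmult (f (lmult m (u d))) a - left_ext m a).
by have := rnorm_ge0 c; nra.
Qed.

Let left_ext_bound m (C : R) : 0 <= C ->
  (forall a, rnorm (lmult m a) <= C * rnorm a) ->
  forall b, rnorm (left_ext m b) <= C * rnorm b.
Proof.
move=> C0 hC b; have [us u1 ul ur] := hu.
apply/ler_addgt0Pr => e e0; have [d hd] := filter_ex (left_extP m b e0).
have := rnormB (lmult (f (lmult m (u d))) b)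
  (lmult (f (lmult m (u d))) b - left_ext m b).
rewrite opprB [_ + (_ - _)]addrCA subrr addr0.
have := star_hom_contractive hf (lmult m (u d)) b.
have : rnorm (lmult m (u d)) * rnorm b <= C * rnorm b.
  rewrite ler_wpM2r ?rnorm_ge0//.
  by have := hC (u d); have := u1 d; have := rnorm_ge0 (u d); nra.
lra.
Qed.

Let left_ext_image m a b : left_ext m (lmult (f a) b) = lmult (f (lmult m a)) b.
Proof.
apply: left_ext_eq => e e0.
have b1 : 0 < rnorm b + 1 by rewrite ltr_pwDr ?rnorm_ge0.
have e20 : 0 < e / (rnorm b + 1) by rewrite !divr_gt0.
apply: filterS (lmult_unit_near FF hu m a e20) => d.
rewrite ltr_pdivlMr// => hd; rewrite -lmult_mul -mf -lmultM.
apply: le_trans (f_dist _ _ _) _.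
by have := rnorm_ge0 (lmult m (u d ** a) - lmult m a); nra.
Qed.

Let left_ext_lip m : exists2 C : R, 0 <= C &
  forall x y, rnorm (left_ext m x - left_ext m y) <= C * rnorm (x - y).
Proof.
have [C C0 hC] := lmult_bound m; exists C => // x y.
by rewrite -(linear_sub (left_ext_linear m)); exact: left_ext_bound.
Qed.

(** The equation on the vectors [f a b] characterizes [left_ext m] among Lipschitz maps; linearity
    in [m], multiplicativity, unitality and agreement with [f] all come from here. *)
Let left_ext_unique m (h : B -> B) (C : R) : 0 <= C ->
  (forall x y, rnorm (h x - h y) <= C * rnorm (x - y)) ->
  (forall a b, h (lmult (f a) b) = lmult (f (lmult m a)) b) ->
  left_ext m =1 h.
Proof.
move=> C0 hC hh; have [C' C'0 hC'] := left_ext_lip m.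
apply: (@dense_eq _ _ (C + C')); first exact: addr_ge0.
- move=> x y; apply: le_trans (hC' _ _) _.
  by rewrite ler_wpM2r ?rnorm_ge0// lerDr.
- move=> x y; apply: le_trans (hC _ _) _.
  by rewrite ler_wpM2r ?rnorm_ge0// lerDl.
- by move=> a b; rewrite left_ext_image hh.
Qed.

Let left_extM m b c : left_ext m (b ** c) = left_ext m b ** c.
Proof.
have [C C0 hC] := left_ext_lip m.
apply: (@dense_eq (fun b => left_ext m (b ** c)) (fun b => left_ext m b ** c)
  (C * rnorm c)).
- by rewrite mulr_ge0 ?rnorm_ge0.
- move=> x y; apply: le_trans (hC _ _) _; rewrite -amulBl -mulrA.
  by rewrite ler_wpM2l// mulrC rnormM.
- move=> x y; rewrite -amulBl; apply: le_trans (rnormM _ _) _.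
  by rewrite mulrAC ler_wpM2r ?rnorm_ge0.
- by move=> a b'; rewrite -lmultM !left_ext_image lmultM.
Qed.

(** The mirror image [f x (g m) = f (x m)] of the defining equation, from which the left and right
    parts are seen to match. *)
Let left_ext_mul x m b :
  lmult (f x) (left_ext m b) = lmult (f (rmult m x)) b.
Proof.
have [C C0 hC] := left_ext_lip m; have [C' C'0 hC'] := lmult_bound (f x).
have [C2 C20 hC2] := lmult_bound (f (rmult m x)).
apply: (@dense_eq (fun b => lmult (f x) (left_ext m b)) (lmult (f (rmult m x)))
  (C' * C + C2)).
- by rewrite addr_ge0 ?mulr_ge0.
- move=> y z; rewrite -lmult_sub; apply: le_trans (hC' _) _.
  rewrite mulrDl -mulrA; apply: le_trans (ler_wpM2l C'0 (hC _ _)) _.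
  by rewrite lerDl mulr_ge0 ?rnorm_ge0.
- move=> y z; rewrite -lmult_sub; apply: le_trans (hC2 _) _.
  by rewrite mulrDl lerDr !mulr_ge0 ?rnorm_ge0.
- by move=> a b'; rewrite left_ext_image -!lmult_mul -!mf rlmult.
Qed.

(** Obtained from the adjoint, so that bounds carry over from [left_ext] and the extension commutes
    with [star]. *)
Definition right_ext m b : B := star (left_ext (star m) (star b)).

Fact strict_ext_subproof m : double_centralizer (left_ext m) (right_ext m).
Proof.
have lin_bound (n : multiplier A) : exists C : R[i],
    forall a, `|left_ext n a| <= C * `|a|.
  have [C C0 hC] := lmult_bound n; exists C%:C => a.
  by rewrite !normrE_rnorm -rmorphM lecR; exact: left_ext_bound.
split.
- by split; [exact: left_ext_linear|exact: lin_bound].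
- split.
    move=> c x y; rewrite /right_ext starD starZ left_ext_linear starD starZ.
    by rewrite conjCK.
  have [C hC] := lin_bound (star m); exists C => a.
  by rewrite /right_ext norm_star -(norm_star a).
- exact: left_extM.
- by move=> a b; rewrite /right_ext starM left_extM starM starK.
- move=> a b.
  have [C C0 hC] := left_ext_lip m.
  apply: (@dense_eq (fun b => right_ext m a ** b) (fun b => a ** left_ext m b)
    (rnorm (right_ext m a) + rnorm a * C)).
  + by rewrite addr_ge0 ?mulr_ge0 ?rnorm_ge0.
  + move=> x y; rewrite -amulBr; apply: le_trans (rnormM _ _) _.
    by rewrite mulrDl lerDl !mulr_ge0 ?rnorm_ge0.
  + move=> x y; rewrite -amulBr; apply: le_trans (rnormM _ _) _.
    rewrite mulrDl -mulrA.
    apply: le_trans (ler_wpM2l (rnorm_ge0 a) (hC x y)) _.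
    by rewrite lerDr !mulr_ge0 ?rnorm_ge0.
  + move=> x b'; rewrite left_ext_image -!rlmult; congr (_ ** _).
    (* Taking adjoints turns the claim into [left_ext_mul] for [star m]. *)
    have rf y z : rmult (f y) z = star (lmult (f (star y)) (star z)).
      by rewrite sf /= !starK.
    by rewrite !rf /right_ext starK left_ext_mul /= starK.
Qed.

Definition strict_ext m : multiplier B := Multiplier (strict_ext_subproof m).

(** On the unit ball the first term does not depend on the multipliers: fix [d] to make it small,
    and then the one strict seminorm at [u_d] controls the rest. *)
Let strict_ext_dist m n b d :
  (forall a, rnorm (lmult m a) <= rnorm a) ->
  (forall a, rnorm (lmult n a) <= rnorm a) ->
  rnorm (left_ext n b - left_ext m b) <= 2 * rnorm (lmult (f (u d)) b - b) +
    rnorm (lmult n (u d) - lmult m (u d)) * rnorm b.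
Proof.
move=> m1 n1; set y := lmult (f (u d)) b.
have l1 p : (forall a, rnorm (lmult p a) <= rnorm a) ->
    rnorm (left_ext p y - left_ext p b) <= rnorm (y - b).
  move=> hp; rewrite -(linear_sub (left_ext_linear p)) -[leRHS]mul1r.
  by apply: left_ext_bound => // a; rewrite mul1r.
have h1 := l1 _ m1; have h2 := l1 _ n1.
have h3 := f_dist (lmult n (u d)) (lmult m (u d)) b.
rewrite -!left_ext_image -/y in h3.
apply: le_trans (rnorm_dist (left_ext n y) _ _) _.
have := rnorm_dist (left_ext m y) (left_ext n y) (left_ext m b).
rewrite (rnorm_distC (left_ext n b)); lra.
Qed.

Lemma strict_extP : is_strict_extension f strict_ext.
Proof.
split; [split| | |].
- move=> c m n; apply: mult_ext_l; have [C C0 hC] := left_ext_lip m.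
  have [C' C'0 hC'] := left_ext_lip n.
  apply: (@left_ext_unique _ _ (rnorm c * C + C')).
  + by rewrite addr_ge0 ?mulr_ge0 ?rnorm_ge0.
  + move=> x y /=; rewrite opprD addrACA -scalerBr.
    apply: le_trans (rnormD _ _) _; rewrite rnormZ mulrDl lerD//.
    by rewrite -mulrA ler_wpM2l ?rnorm_ge0.
  + by move=> a b /=; rewrite !left_ext_image lf.
- move=> m n; apply: mult_ext_l; have [C C0 hC] := left_ext_lip m.
  have [C' C'0 hC'] := left_ext_lip n.
  apply: (@left_ext_unique _ _ (C * C')); first by rewrite mulr_ge0.
  + move=> x y /=; apply: le_trans (hC _ _) _.
    by rewrite -mulrA ler_wpM2l.
  + by move=> a b /=; rewrite !left_ext_image.
- by move=> m; apply: mult_ext_l => b /=; rewrite /right_ext !starK.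
- apply: mult_ext_l; apply: (@left_ext_unique _ _ 1) => // x y.
  by rewrite mul1r.
- move=> a; apply: mult_ext_l; have [C C0 hC] := lmult_bound (f a).
  apply: (@left_ext_unique _ _ C) => //.
    by move=> x y; rewrite -lmult_sub.
  by move=> x b /=; rewrite -lmult_mul -mf.
- apply/subspace_continuousP => m /= m1.
  have FW : Filter (within [set m | mult_norm m <= 1] (nbhs m)).
    exact: within_filter.
  have hm1 := mult_norm_le1 m1.
  have star1 (p : multiplier A) : (forall a, rnorm (lmult p a) <= rnorm a) ->
      forall a, rnorm (lmult (star p) a) <= rnorm a.
    move=> hp a; rewrite /= rnorm_star -[leRHS]rnorm_star -[leRHS]mul1r.
    by apply: rmult_norm => // b; rewrite mul1r.
  apply: strict_cvg => b e e0 /=.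
  + have b1 : 0 < rnorm b + 1 by rewrite ltr_pwDr ?rnorm_ge0.
    have e20 : 0 < e / (rnorm b + 1) / 2 by rewrite !divr_gt0.
    have e40 : 0 < e / 4 by lra.
    have [d hd] := filter_ex (fu b e40).
    have [hn _] := strict_near m (u d) e20.
    apply: (@filterS _ _ (nbhs_filter m) _ _ _ hn) => n + n1.
    rewrite ltr_pdivlMr// ltr_pdivlMr// => hn'.
    apply: le_lt_trans (strict_ext_dist b d hm1 (mult_norm_le1 n1)) _.
    by have := rnorm_ge0 (lmult n (u d) - lmult m (u d)); nra.
  (* The right seminorm at [b] is the left seminorm of the adjoint at [star b]. *)
  + have b1 : 0 < rnorm b + 1 by rewrite ltr_pwDr ?rnorm_ge0.
    have e20 : 0 < e / (rnorm b + 1) / 2 by rewrite !divr_gt0.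
    have e40 : 0 < e / 4 by lra.
    have [d hd] := filter_ex (fu (star b) e40).
    have [_ hn] := strict_near m (u d) e20.
    apply: (@filterS _ _ (nbhs_filter m) _ _ _ hn) => n + n1.
    rewrite ltr_pdivlMr// ltr_pdivlMr// => hn'.
    rewrite /right_ext -starB rnorm_star.
    have [us _ _ _] := hu.
    have := strict_ext_dist (star b) d (star1 _ hm1) (star1 _ (mult_norm_le1 n1)).
    rewrite /= us -starB !rnorm_star => h; apply: le_lt_trans h _.
    by have := rnorm_ge0 (rmult n (u d) - rmult m (u d)); nra.
Qed.

End StrictExtension.

Lemma strict_extensionP (R : realType) (A B : cstarAlgType R)
    (f : A -> multiplier B) :
  relatively_proper f -> is_strict_extension f (strict_extension f).
Proof.
move=> [hf [D [le [u [/approximate_identity_unit[FF hu] _ fu]]]]].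
have fu' b (e : R) : 0 < e ->
    \forall d \near tails le, rnorm (lmult (f (u d)) b - b) < e.
  by move=> e0; have [h _] := strict_near (mult_one B) b e0; exact: fu h.
have := xgetPex (fun=> 0) (ex_intro _ _ (strict_extP hf FF hu fu')).
exact.
Qed.

(** * Pullbacks of states *)

Section Pullback.
Variables (R : realType) (A : cstarAlgType R).
Variables (D : Type) (F : set_system D) (FF : ProperFilter F) (u : D -> A).
Hypothesis hu : approx_unit F u.
Implicit Types (phi psi : A -> R[i]) (f g : A -> multiplier A).

(** Contractivity of [f] bounds the norm by 1. It is attained in the limit because [f (u'_d)] tends
    strictly to the unit, where the extended state equals 1. *)
Lemma pullback_state f phi :
  relatively_proper f -> is_state phi -> is_state (pullback f phi).
Proof.
move=> [hf [D' [le [u' [/approximate_identity_unit[FF' hu'] _ fu]]]]] hphi.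
have [lf mf sf] := hf; have [us u1 ul ur] := hu'.
have [[sPhi pPhi _] cPhi _] := state_extensionP FF hu hphi.
apply: stateP.
- by move=> c x y; rewrite /pullback lf sPhi.
- by move=> x; rewrite /pullback mf sf pPhi.
- move=> a; apply: (state_extension_bound FF hu) => //.
    exact: rnorm_ge0.
  exact: star_hom_contractive.
- move=> e e0.
  have [d] := filter_ex (state_extension_cvg FF hu _ hphi fu e0).
  rewrite (state_extension_one FF hu hphi) => hd; exists (u' d); first exact: u1.
  rewrite /pullback; set z := state_extension _ _ in hd *.
  have := rnormD z (1 - z); rewrite addrC subrK (rnorm_distC 1).
  have -> : rnorm (1 : R[i]) = 1 by rewrite /rnorm normr1.
  lra.
Qed.

Lemma pullback_embed phi : is_state phi -> pullback (@mult_embed R A) phi = phi.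
Proof.
move=> hphi; apply/funext => a; rewrite /pullback.
by have [_ _ ->] := state_extensionP FF hu hphi.
Qed.

(** Relative properness provides an approximate identity adapted to [f]; the extension, strictly
    continuous on the unit ball, transfers the convergence to the common [u]. *)
Lemma strict_extension_unit f : relatively_proper f ->
  f (u d) @[d --> F] --> mult_one A.
Proof.
move=> hf; have [_ g1 ge /subspace_continuousP gc] := strict_extensionP hf.
have [us u1 ul ur] := hu.
have b1 : mult_norm (mult_one A) <= 1.
  by apply: mult_norm_le => // a; rewrite mul1r.
have ue : mult_embed (u d) @[d --> F] --> mult_one A.
  by apply: strict_cvg => b e e0; [exact: ul|exact: ur].
move=> U; rewrite -g1 => /(gc _ b1) hU.
apply: (@filterS _ F _ _ _ _ (ue _ hU)) => d; rewrite /from_subspace /= ge; apply.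
exact: le_trans (mult_norm_embed _) (u1 d).
Qed.

Lemma strict_mul_cvg (m : multiplier A) (h : D -> multiplier A) :
  h @ F --> mult_one A -> (m ** h d) @[d --> F] --> m.
Proof.
move=> h1; have [C C0 hC] := lmult_bound m.
apply: strict_cvg => b e e0.
  have e10 : 0 < e / (C + 1) by rewrite divr_gt0// ltr_pwDr.
  have [hb _] := strict_near (mult_one A) b e10.
  apply: (@filterS _ F _ _ _ _ (h1 _ hb)) => d /=.
  rewrite ltr_pdivlMr ?ltr_pwDr// => hd.
  rewrite -lmult_sub; apply: le_lt_trans (hC _) _.
  by move: hd => /=; have := rnorm_ge0 (lmult (h d) b - b); nra.
have [_ hb] := strict_near (mult_one A) (rmult m b) e0.
exact: (h1 _ hb).
Qed.

(** With [m = g a] and [f] also denoting the extension, the right side is the limit of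
    [Phi (f (m u_d)) = Phi (f m ** f (u_d))], and [f (u_d)] tends strictly to the unit. *)
Lemma pullback_comp f g phi : relatively_proper f -> is_state phi ->
  pullback (strict_extension f \o g) phi = pullback g (pullback f phi).
Proof.
move=> hf hphi; apply/funext => a; rewrite /pullback /=; set m := g a.
have hp := pullback_state hf hphi.
have [[lG mG sG] g1 ge _] := strict_extensionP hf.
have hG := strict_mul_cvg (m := strict_extension f m) (strict_extension_unit hf).
apply: rnorm_eq => e e0; have e20 : 0 < e / 2 by lra.
have [d [h1 h2]] := filter_ex (@filterI _ F _ _ _
  (state_extension_unit FF hu m hp e20)
  (state_extension_cvg FF hu FF hphi hG e20)).
move: h1; rewrite {1}/pullback -ge -mult_embedM mG ge => h1.
apply: le_trans (rnorm_dist
  (state_extension phi (strict_extension f m ** f (u d))) _ _) _.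
rewrite rnorm_distC; lra.
Qed.

(** * Convex combinations of states *)

Section Convex.
Variables (J : finType) (w : J -> R) (phi : J -> A -> R[i]).
Hypotheses (w0 : forall j, 0 <= w j) (w1 : \sum_j w j = 1).
Hypothesis hphi : forall j, is_state (phi j).

Definition convex_comb (phi : J -> A -> R[i]) : A -> R[i] :=
  fun a => \sum_j (w j)%:C * phi j a.

Lemma convex_dist (h k : J -> R[i]) (e : R) :
  (forall j, rnorm (h j - k j) <= e) ->
  rnorm (\sum_j (w j)%:C * h j - \sum_j (w j)%:C * k j) <= e.
Proof.
move=> hk; rewrite -sumrB -[e]mul1r -w1 mulr_suml.
have big_le (g : J -> R[i]) : rnorm (\sum_j g j) <= \sum_j rnorm (g j).
  elim/big_ind2 : _ => [|x y x' y' hx hx'|//]; first by rewrite rnorm0.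
  by apply: le_trans (rnormD _ _) _; exact: lerD.
apply: le_trans (big_le _) _; apply: ler_sum => j _.
by rewrite -mulrBr rnormCM rnormCr ger0_norm// ler_wpM2l.
Qed.

Lemma convex_const (z : R[i]) : \sum_j (w j)%:C * z = z.
Proof. by rewrite -mulr_suml -rmorph_sum /= w1 mul1r. Qed.

Lemma near_all (P : J -> D -> Prop) :
  (forall j, \forall d \near F, P j d) -> exists d, forall j, P j d.
Proof. by move=> h; exact: (filter_ex (@filter_forall _ _ P F FF h)). Qed.

(** Norm one survives because finitely many states are all close to 1 at one common [u_d], so
    nothing cancels. *)
Lemma convex_state : is_state (convex_comb phi).
Proof.
have [us u1 ul ur] := hu; apply: stateP.
- move=> c x y; rewrite /convex_comb mulr_sumr -big_split /=.
  apply: eq_bigr => j _; rewrite (state_scalar (hphi j)) mulrDr.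
  by rewrite !mulrA [c * _]mulrC.
- move=> x; apply: sumr_ge0 => j _; apply: mulr_ge0.
    by rewrite ler0c.
  exact: state_ge0.
- move=> a; have := @convex_dist (fun j => phi j a) (fun=> 0) (rnorm a).
  rewrite convex_const subr0; apply => j; rewrite subr0; exact: state_norm.
- move=> e e0; have [d hd] := near_all (fun j => state_unit FF hu (hphi j) e0).
  have e20 : 0 < e / 2 by lra.
  have [d' hd'] := near_all (fun j => state_unit FF hu (hphi j) e20).
  exists (u d'); first exact: u1.
  have := @convex_dist (fun j => phi j (u d')) (fun=> 1) (e / 2).
  rewrite convex_const => /(_ (fun j => ltW (hd' j))).
  set z := convex_comb _ _; rewrite -[X in rnorm (X - _)]/z.
  have := rnormD z (1 - z); rewrite addrC subrK (rnorm_distC 1).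
  have -> : rnorm (1 : R[i]) = 1 by rewrite /rnorm normr1.
  lra.
Qed.

(** Affinity of the picked extension in the state is not definitional: it follows by evaluating all
    extensions, including that of the combination, at one common [m u_d]. *)
Lemma pullback_convex f :
  pullback f (convex_comb phi) = convex_comb (fun j => pullback f (phi j)).
Proof.
apply/funext => a; set m := f a; rewrite /pullback -/m.
apply: rnorm_eq => e e0; have e20 : 0 < e / 2 by lra.
have [d hd] := near_all (fun j => @filterI _ F _ _ _
  (state_extension_unit FF hu m (hphi j) e20)
  (state_extension_unit FF hu m convex_state e20)).
apply: le_trans (rnorm_dist (convex_comb phi (lmult m (u d))) _ _) _.
have h2 := @convex_dist (fun j => phi j (lmult m (u d)))
  (fun j => state_extension (phi j) m) (e / 2) (fun j => ltW (hd j).1).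
have [j0 _] : exists j : J, true.
  apply: contrapT => hJ; move: w1; rewrite big1 => [/eqP|j _].
    by rewrite eq_sym oner_eq0.
  by case: hJ; exists j.
have := (hd j0).2; rewrite rnorm_distC /convex_comb /pullback -/m; lra.
Qed.

End Convex.
End Pullback.

(** * The distance of states *)

Section Distance.
Variables (R : realType) (A : cstarAlgType R) (L : A -> \bar R).
Implicit Types (phi psi chi : A -> R[i]).

(** A real bound on [state_dist], which keeps the contraction arguments free of infinite values. *)
Definition dist_le phi psi (c : R) : Prop :=
  forall b, selfadjoint b -> (L b <= 1)%E -> rnorm (phi b - psi b) <= c.

Lemma state_dist_leP phi psi (c : R) :
  (state_dist L phi psi <= c%:E)%E <-> dist_le phi psi c.
Proof.
split=> [h b bs bL|h].
  rewrite -lee_fin; apply: le_trans h; apply: ereal_sup_ubound.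
  by exists b.
by apply: ge_ereal_sup => _ [b [bs bL] <-]; rewrite lee_fin; exact: h.
Qed.

Lemma dist_le_trans psi phi chi (c d : R) :
  dist_le phi psi c -> dist_le psi chi d -> dist_le phi chi (c + d).
Proof.
move=> h1 h2 b bs bL; apply: le_trans (rnorm_dist (psi b) _ _) _.
by apply: lerD; [exact: h1|exact: h2].
Qed.

Lemma dist_le_sym phi psi (c : R) : dist_le phi psi c -> dist_le psi phi c.
Proof. by move=> h b bs bL; rewrite rnorm_distC; exact: h. Qed.

Lemma dist_leW phi psi (c d : R) : c <= d -> dist_le phi psi c ->
  dist_le phi psi d.
Proof. by move=> cd h b bs bL; exact: le_trans (h b bs bL) cd. Qed.

Hypothesis hL : complete_spectral_metric_space L.

Lemma seminorm0 : L 0 = 0%E.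
Proof.
have [[_ Lh _] _ _ _] := hL.
have := Lh 0 0 (star0 A); rewrite scaler0 => ->.
by rewrite normr0 mul0e.
Qed.

Lemma state_dist_ge0 phi psi : (0 <= state_dist L phi psi)%E.
Proof.
apply: (@le_trans _ _ (rnorm (phi 0 - psi 0))%:E).
  by rewrite lee_fin rnorm_ge0.
apply: ereal_sup_ubound; exists 0 => //; split; first exact: star0.
by rewrite seminorm0 lee01.
Qed.

Lemma dist_le_ge0 phi psi (c : R) : dist_le phi psi c -> 0 <= c.
Proof.
move=> /state_dist_leP h; rewrite -lee_fin; apply: le_trans h.
exact: state_dist_ge0.
Qed.

Lemma state_dist_finP phi psi :
  (state_dist L phi psi < +oo)%E <-> exists c : R, dist_le phi psi c.
Proof.
split=> [h|[c /state_dist_leP h]]; last exact: le_lt_trans h (ltry _).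
have := state_dist_ge0 phi psi.
case E : (state_dist L phi psi) h => [c||] // _ _; exists c.
by apply/state_dist_leP; rewrite E.
Qed.

Lemma dist_le_scale phi psi (c K : R) b : scalar phi -> scalar psi -> 0 < K ->
  dist_le phi psi c -> selfadjoint b -> (L b <= K%:E)%E ->
  rnorm (phi b - psi b) <= K * c.
Proof.
move=> sphi spsi K0 h bs bL; have [[_ Lh _] _ _ _] := hL.
have := h (K^-1%:C *: b); rewrite Lh// ger0_norm ?invr_ge0 ?(ltW K0)//.
rewrite !scalar_scale// -mulrBr rnormCM rnormCr ger0_norm ?invr_ge0 ?(ltW K0)//.
rewrite mulrC ler_pdivrMr// mulrC; apply.
  rewrite /selfadjoint starZ bs; congr (_ *: _).
  by apply/eqP; rewrite /Num.conj eq_complex /= oppr0 !eqxx.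
have -> : 1%E = (K^-1%:E * K%:E)%E by rewrite -EFinM mulVf ?gt_eqF.
by apply: lee_wpmul2l => //; rewrite lee_fin invr_ge0 ltW.
Qed.

Lemma seminorm_dense a (e : R) : selfadjoint a -> 0 < e ->
  exists b, [/\ selfadjoint b, rnorm (a - b) < e
    & exists2 K : R, 0 < K & (L b <= K%:E)%E].
Proof.
move=> sa e0; have [[Lge _ _] Ld _ _] := hL.
have := Ld _ sa => /(_ (ball a e%:C)).
case; first by apply: nbhsx_ballx; rewrite ltcR.
move=> b [[sb Lb]]; rewrite -ball_normE /= -rnorm_ltP => hb; exists b; split=> //.
(* [r + 1] rather than [r], since [L b] may vanish and the bound has to be positive for scaling. *)
have := Lge _ sb; case E : (L b) Lb => [r||] // _ r0; exists (r + 1).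
  by move: r0; rewrite lee_fin => r0; rewrite ltr_pwDr.
by rewrite lee_fin lerDl.
Qed.

Lemma selfadjoint_decomp (a : A) : exists x y,
  [/\ selfadjoint x, selfadjoint y & a = x + 'i%C *: y].
Proof.
have hh : Num.conj (half : R[i]) = half.
  by apply/eqP; rewrite /half /Num.conj eq_complex /= oppr0 !eqxx.
have ci : Num.conj 'i%C = - 'i%C :> R[i].
  by apply/eqP; rewrite /Num.conj eq_complex /= oppr0 !eqxx.
exists (half *: (a + star a)), (half *: ('i%C *: (star a - a))); split.
- by rewrite /selfadjoint starZ hh starD starK addrC.
- rewrite /selfadjoint !starZ hh ci starB starK.
  by rewrite scaleNr -scalerN opprB.
- have ii : 'i%C * 'i%C = -1 :> R[i] by rewrite -expr2 sqr_i.
  have -> (z : A) : 'i%C *: (half *: ('i%C *: z)) = half *: (- z).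
    by rewrite -(scaleN1r z) !scalerA -ii mulrCA mulrA.
  rewrite opprB.
  by rewrite -scalerDr addrACA subrr addr0 scalerDr half_double.
Qed.

(** States agree where [L] is finite, hence by density and boundedness on self-adjoint elements,
    hence everywhere. *)
Lemma state_eq phi psi : is_state phi -> is_state psi ->
  (forall e : R, 0 < e -> dist_le phi psi e) -> phi = psi.
Proof.
move=> hphi hpsi h.
have sphi := state_scalar hphi; have spsi := state_scalar hpsi.
have sa a : selfadjoint a -> phi a = psi a.
  move=> sa; apply: rnorm_eq => e e0; have e40 : 0 < e / 4 by lra.
  have [b [sb ab [K K0 bK]]] := seminorm_dense sa e40.
  have eK : 0 < e / 4 / K by rewrite divr_gt0.
  have := dist_le_scale sphi spsi K0 (h _ eK) sb bK.
  have -> : K * (e / 4 / K) = e / 4 by field; rewrite gt_eqF.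
  have := state_norm hphi (a - b); have := state_norm hpsi (a - b).
  rewrite !scalar_sub//.
  have := rnorm_dist (phi b) (phi a) (psi a).
  have := rnorm_dist (psi b) (phi b) (psi a).
  by rewrite (rnorm_distC (psi b)); lra.
apply/funext => a; have [x [y [sx sy ->]]] := selfadjoint_decomp a.
by rewrite !scalar_add// !scalar_scale// !sa.
Qed.

Lemma seminorm_unit : exists (D : Type) (F : set_system D) (u : D -> A),
  [/\ ProperFilter F, approx_unit F u, forall d, selfadjoint (u d)
    & forall K : R, 0 < K -> \forall d \near F, (L (u d) <= K%:E)%E].
Proof.
have [_ _ [D [le [u [hu Lu]]]] _] := hL.
have [FF hu'] := approximate_identity_unit hu; exists D, (tails le), u.
split=> // [d|K K0]; first by case: hu' => us _ _ _; exact: us.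
have : nbhs (0 : \bar R)%E [set x : \bar R | (x < K%:E)%E].
  by apply: open_nbhs_nbhs; split; [exact: open_ereal_lt_ereal|rewrite /= lte_fin].
by move=> /Lu; apply: (@filterS _ _ FF) => d /=; exact: ltW.
Qed.

(* The limit functional has norm one because [L (u_d) -> 0] makes
   [phi_n (u_d) -> 1] uniformly in [n]. *)
Lemma state_dist_complete (x : nat -> A -> R[i]) (C q : R) :
  0 <= q < 1 -> (forall n, is_state (x n)) ->
  (forall n, dist_le (x n) (x n.+1) (C * q ^+ n)) ->
  exists2 phi, is_state phi &
    forall n, dist_le (x n) phi (C / (1 - q) * q ^+ n).
Proof.
move=> q01 hx hd; have C0 : 0 <= C.
  by have := dist_le_ge0 (hd 0%N); rewrite expr0 mulr1.
have [q0 q1] := andP q01; set E := C / (1 - q).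
have E0 : 0 <= E by rewrite divr_ge0// subr_ge0 ltW.
have sx n := state_scalar (hx n).
have key n m : (n <= m)%N -> dist_le (x n) (x m) (E * q ^+ n).
  move=> nm b bs bL.
  apply: (@geometric_dist _ (fun n m => rnorm (x n b - x m b))) => //.
  - by move=> k; rewrite subrr rnorm0.
  - by move=> i j k; exact: rnorm_dist.
  - by move=> k; exact: hd.
(* The distance controls only elements with finite [L]; approximating [a] by such a [b] costs
   [e / 4] for each of the two states, uniformly in the index. *)
have cs a : selfadjoint a -> forall e : R, 0 < e ->
    exists N, forall n, (N <= n)%N -> rnorm (x n a - x N a) < e.
  move=> sa e e0; have e40 : 0 < e / 4 by lra.
  have [b [sb ab [K K0 bK]]] := seminorm_dense sa e40.
  have [N _ hN] := geometric_small (K * E) q01 e40.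
  exists N => n Nn.
  have h1 := dist_le_scale (sx N) (sx n) K0 (key _ _ Nn) sb bK.
  have /= h2 := hN N (leqnn _).
  have := state_norm (hx n) (a - b); have := state_norm (hx N) (a - b).
  rewrite !scalar_sub//.
  have := rnorm_dist (x n b) (x n a) (x N a).
  have := rnorm_dist (x N b) (x n b) (x N a).
  rewrite (rnorm_distC (x n b) (x N b)) (rnorm_distC (x N b) (x N a)).
  by rewrite mulrA in h1; lra.
have ca a (e : R) : 0 < e ->
    exists N, \forall n \near \oo, rnorm (x n a - x N a) < e.
  move=> e0; have e40 : 0 < e / 4 by lra.
  have [y [z [sy sz ->]]] := selfadjoint_decomp a.
  have [N1 h1] := cs _ sy _ e40; have [N2 h2] := cs _ sz _ e40.
  exists (maxn N1 N2); exists (maxn N1 N2) => // n /=; rewrite geq_max.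
  move=> /andP[n1 n2].
  rewrite !scalar_add// !scalar_scale// opprD addrACA -mulrBr.
  apply: le_lt_trans (rnormD _ _) _; rewrite rnormCM.
  have -> : rnorm ('i%C : R[i]) = 1.
    by rewrite /rnorm normc_def /= expr0n /= add0r expr1n sqrtr1.
  have := rnorm_dist (x N1 y) (x n y) (x (maxn N1 N2) y).
  have := rnorm_dist (x N2 z) (x n z) (x (maxn N1 N2) z).
  have := h1 _ n1; have := h2 _ n2; have := h1 _ (leq_maxl N1 N2).
  have := h2 _ (leq_maxr N1 N2).
  rewrite (rnorm_distC (x N1 y)) (rnorm_distC (x N2 z)); lra.
have lim a := cid (cauchy_complex eventually_filter (ca a)).
pose phi a := projT1 (lim a).
have phiP a (e : R) : 0 < e -> \forall n \near \oo, rnorm (x n a - phi a) < e.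
  exact: (projT2 (lim a)).
have sphi : scalar phi.
  move=> c y z; apply: rnorm_eq => e e0.
  have c10 : 0 < rnorm c + 1 by rewrite ltr_pwDr ?rnorm_ge0.
  have e10 : 0 < e / (rnorm c + 1) / 3 by rewrite !divr_gt0.
  have e30 : 0 < e / 3 by lra.
  have [n [[h1 h2] h3]] := filter_ex (@filterI _ \oo _ _ _ (@filterI _ \oo _ _ _
    (phiP y _ e10) (phiP z _ e30)) (phiP (c *: y + z) _ e30)).
  move: h1; rewrite ltr_pdivlMr// ltr_pdivlMr// => h1.
  apply: le_trans (rnorm_dist (x n (c *: y + z)) _ _) _.
  rewrite rnorm_distC {2}sx opprD addrACA -mulrBr.
  have := rnormD (c * (x n y - phi y)) (x n z - phi z); rewrite rnormCM.
  by have := rnorm_ge0 (x n y - phi y); have := rnorm_ge0 c; nra.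
have dphi n : dist_le (x n) phi (E * q ^+ n).
  move=> b bs bL; apply/ler_addgt0Pr => e e0.
  have [N _ hN] := phiP b _ e0.
  apply: le_trans (rnorm_dist (x (maxn N n) b) _ _) _.
  apply: lerD; first by apply: key => //; exact: leq_maxr.
  by apply/ltW/hN; rewrite /= leq_maxl.
exists phi => //; apply: stateP => //.
- move=> a; apply: complex_limit_ge0 => e e0.
  have [n hn] := filter_ex (phiP (star a ** a) _ e0).
  by exists (x n (star a ** a)); [exact: state_ge0|rewrite rnorm_distC].
- move=> a; apply/ler_addgt0Pr => e e0; have [n hn] := filter_ex (phiP a _ e0).
  have := rnormB (x n a) (x n a - phi a).
  by rewrite opprB [_ + (_ - _)]addrCA subrr addr0; have := state_norm (hx n) a; lra.
- move=> e e0; have [D [F [u [FF hu us Lu]]]] := seminorm_unit.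
  have e20 : 0 < e / 2 by lra.
  have E1 : 0 < E + 1 by rewrite ltr_pwDr.
  (* [phi] is within [E] of [x 0], so at [u_d] with [L (u_d)] below this constant they differ by
     less than [e / 2]; the other half is the defect [1 - x 0 (u_d)]. *)
  have eE : 0 < e / 2 / (E + 1) by rewrite !divr_gt0.
  have [d [h1 h2]] := filter_ex (@filterI _ F _ _ _
    (state_unit FF hu (hx 0%N) e20) (Lu _ eE)).
  exists (u d); first by case: hu.
  have := dist_le_scale (sx 0%N) sphi eE (dphi 0%N) (us d) h2.
  rewrite expr0 mulr1.
  have -> : e / 2 / (E + 1) * E = e / 2 - e / 2 / (E + 1).
    by field; rewrite gt_eqF.
  have := rnorm_dist (x 0%N (u d)) 1 (phi (u d)).
  have := rnormD (phi (u d)) (1 - phi (u d)); rewrite addrC subrK.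
  have -> : rnorm (1 : R[i]) = 1 by rewrite /rnorm normr1.
  rewrite (rnorm_distC 1 (x 0%N _)); lra.
Qed.

(** * Banach's fixed point theorem on states *)

Section Contraction.
Variables (T : (A -> R[i]) -> A -> R[i]) (q : R).
Hypothesis q01 : 0 <= q < 1.
Hypothesis Tstate : forall phi, is_state phi -> is_state (T phi).
Hypothesis Tcontr : forall phi psi c, is_state phi -> is_state psi ->
  dist_le phi psi c -> dist_le (T phi) (T psi) (q * c).

Lemma contraction_iter n phi : is_state phi -> is_state (iter n T phi).
Proof. by elim: n phi => //= n IH phi hphi; apply/Tstate/IH. Qed.

Lemma contraction_iter_dist n phi psi c : is_state phi -> is_state psi ->
  dist_le phi psi c -> dist_le (iter n T phi) (iter n T psi) (c * q ^+ n).
Proof.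
move=> hphi hpsi h; elim: n => [|n IH]; first by rewrite expr0 mulr1.
rewrite exprS mulrCA /=; apply: Tcontr IH; exact: contraction_iter.
Qed.

Lemma contraction_fixpoint phi0 C : is_state phi0 -> dist_le phi0 (T phi0) C ->
  exists phi, [/\ is_state phi, T phi = phi
    & forall n, dist_le (iter n T phi0) phi (C / (1 - q) * q ^+ n)].
Proof.
move=> hphi0 h0; have C0 := dist_le_ge0 h0.
have [q0 q1] := andP q01.
have [|n|phi hphi dphi] := @state_dist_complete (fun n => iter n T phi0) C q q01.
- by move=> n; exact: contraction_iter.
- by rewrite iterSr; apply: contraction_iter_dist => //; exact: Tstate.
exists phi; split=> //; apply: state_eq => //; first exact: Tstate.
move=> e e0; have e20 : 0 < e / 2 by lra.
have [n _ hn] := geometric_small (C / (1 - q)) q01 e20.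
(* The iterate [n.+1] lies between [T phi] and [phi], close to both. *)
have h1 := dist_le_sym (Tcontr (contraction_iter n hphi0) hphi (dphi n)).
have h2 := dphi n.+1.
apply: dist_leW (dist_le_trans h1 h2).
have /= := hn n (leqnn _); have /= := hn n.+1 (leqnSn _).
have : 0 <= C / (1 - q) * q ^+ n.
  by rewrite mulr_ge0 ?exprn_ge0// divr_ge0// subr_ge0 ltW.
nra.
Qed.

Lemma contraction_unique phi psi C : is_state phi -> is_state psi ->
  T phi = phi -> T psi = psi -> dist_le phi psi C -> phi = psi.
Proof.
move=> hphi hpsi Tphi Tpsi h; apply: state_eq => // e e0.
have [n _ hn] := geometric_small C q01 e0.
have := contraction_iter_dist n hphi hpsi h.
have it chi : T chi = chi -> iter n T chi = chi.
  by move=> hT; elim: n {hn} => //= n ->.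
by rewrite !it//; apply: dist_leW; apply/ltW/hn => /=.
Qed.

End Contraction.
End Distance.

(** * Self-similar states *)

Section SimilarStates.
Variables (R : realType) (A : cstarAlgType R) (L : A -> \bar R).
Hypothesis hL : complete_spectral_metric_space L.
Variables (D : Type) (U : set_system D) (FU : ProperFilter U) (u : D -> A).
Hypothesis hu : approx_unit U u.
Implicit Types phi psi : A -> R[i].

(** [mult_seminorm] is an infimum, so a [q] strictly above the dilation is what yields an admissible
    Lipschitz constant [C < q] for each [f b]. *)
Lemma pullback_contraction (f : A -> multiplier A) (q c : R) phi psi :
  (dilation L f < q%:E)%E -> is_state phi -> is_state psi ->
  dist_le L phi psi c -> dist_le L (pullback f phi) (pullback f psi) (q * c).
Proof.
move=> fq hphi hpsi h b sb bL; have c0 := dist_le_ge0 hL h.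
have : (mult_seminorm L (f b) < q%:E)%E.
  by apply: le_lt_trans fq; apply: ereal_sup_ubound; exists b.
move=> /ereal_inf_lt[_ [C [C0 hC] <-]]; rewrite lte_fin => Cq.
rewrite -lee_fin; apply: le_trans (hC _ _ hphi hpsi) _.
apply: (@le_trans _ _ (C%:E * c%:E)%E).
  by apply: lee_wpmul2l; [rewrite lee_fin ltW|apply/state_dist_leP].
by rewrite -EFinM lee_fin ler_wpM2r// ltW.
Qed.

(** The index 0 is left out because the empty word acts as the identity and singles out no fixed
    state. *)
Lemma state_dist_cvg0 (x : nat -> A -> R[i]) phi (C q : R) : 0 <= q < 1 ->
  (forall n, (0 < n)%N -> dist_le L (x n) phi (C * q ^+ n)) ->
  state_dist L (x n) phi @[n --> \oo] --> 0%E.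
Proof.
move=> /andP[q0 q1] h.
apply: (@squeeze_cvge _ _ _ _ (fun=> 0%E) _ (fun n => (C * q ^+ n)%:E)).
- exists 1%N => // n n1; apply/andP; split; first exact: state_dist_ge0.
  by apply/state_dist_leP/h.
- exact: cvg_cst.
- apply: cvg_EFin; first exact: nearW.
  rewrite -(mulr0 C); apply: cvgM; first exact: cvg_cst.
  by apply: cvg_expr; rewrite ger0_norm.
Qed.

Lemma big_tuple_cons (V : nmodType) (k n : nat) (G : n.+1.-tuple 'I_k -> V) :
  \sum_(w : n.+1.-tuple 'I_k) G w =
  \sum_(i < k) \sum_(w : n.-tuple 'I_k) G (cons_tuple i w).
Proof.
rewrite pair_bigA /=
  (reindex (fun s : 'I_k * n.-tuple 'I_k => cons_tuple s.1 s.2)) //=.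
exists (fun t => (thead t, behead_tuple t)) => [[i w] _|t _].
  by rewrite theadE; congr pair; apply: val_inj.
by rewrite [RHS]tuple_eta; apply: val_inj.
Qed.

Variables (k : nat) (F : 'I_k -> A -> multiplier A) (p : 'I_k -> R) (q : R).
Hypotheses (hF : forall i, relatively_proper (F i)) (hp : open_simplex p).
Hypotheses (q01 : 0 <= q < 1) (hq : forall i, (dilation L (F i) < q%:E)%E).

Let p0 i : 0 <= p i.
Proof. by case: hp => h _; case/andP: (h i) => /ltW. Qed.

Let p1 : \sum_i p i = 1. Proof. by case: hp. Qed.

Let q0 : 0 <= q. Proof. by case/andP: q01. Qed.
Let q1 : 0 < 1 - q. Proof. by rewrite subr_gt0; case/andP: q01. Qed.

(** Pullback reverses composition, so the first letter acts first. Peeling it off calls for relative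
    properness of the outer map [F i] alone, never of a composite. *)
Lemma pullback_word_cons i w phi : is_state phi ->
  pullback (word_map F (i :: w)) phi =
  pullback (word_map F w) (pullback (F i) phi).
Proof. by move=> hphi; exact: (pullback_comp FU hu). Qed.

Lemma word_is_state w phi :
  is_state phi -> is_state (pullback (word_map F w) phi).
Proof.
elim: w phi => [|i w IH] phi hphi; first by rewrite (pullback_embed FU hu).
by rewrite pullback_word_cons//; apply/IH/(pullback_state FU hu).
Qed.

Lemma word_contraction w phi psi c : is_state phi -> is_state psi ->
  dist_le L phi psi c ->
  dist_le L (pullback (word_map F w) phi) (pullback (word_map F w) psi)
    (q ^+ size w * c).
Proof.
elim: w phi psi c => [|i w IH] phi psi c hphi hpsi h.
  by rewrite !(pullback_embed FU hu)// expr0 mul1r.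
rewrite !pullback_word_cons// exprSr -mulrA.
apply: IH; [exact: (pullback_state FU hu)|exact: (pullback_state FU hu)|].
exact: pullback_contraction.
Qed.

Lemma markov_is_state phi : is_state phi -> is_state (markov_op F p phi).
Proof.
move=> hphi; apply: (convex_state FU hu p0 p1 (phi := fun i => pullback (F i) phi)).
by move=> i; exact: (pullback_state FU hu).
Qed.

Lemma convex_dist_le (J : finType) (w : J -> R) (x y : J -> A -> R[i]) (c : R) :
  (forall j, 0 <= w j) -> \sum_j w j = 1 -> (forall j, dist_le L (x j) (y j) c) ->
  dist_le L (convex_comb w x) (convex_comb w y) c.
Proof.
by move=> w0 w1 h b sb bL; apply: convex_dist => // j; exact: h.
Qed.

Lemma markov_contraction phi psi c : is_state phi -> is_state psi ->
  dist_le L phi psi c ->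
  dist_le L (markov_op F p phi) (markov_op F p psi) (q * c).
Proof.
move=> hphi hpsi h; apply: convex_dist_le => // i.
exact: pullback_contraction.
Qed.

Lemma word_weight_ge0 w : 0 <= word_weight p w.
Proof. by apply: prodr_ge0. Qed.

Lemma word_weight_sum n : \sum_(w : n.-tuple 'I_k) word_weight p w = 1.
Proof.
elim: n => [|n IH].
  rewrite (bigD1 [tuple])//= big1 ?addr0 => [|w].
    by rewrite /word_weight big_nil.
  by move=> /eqP[]; exact: tuple0.
rewrite big_tuple_cons -p1; apply: eq_bigr => i _.
rewrite -[RHS]mulr1 -IH mulr_sumr; apply: eq_bigr => w _.
by rewrite /word_weight big_cons.
Qed.

(** The induction takes the innermost application first: [f_w^*] is affine on states, so it
    distributes over the sum of the [p_i f_i^* phi], and [f_w^* f_i^*] is the pullback along the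
    word [i :: w]. *)
Lemma markov_iter_words n phi : is_state phi ->
  iter n (markov_op F p) phi =
  convex_comb (fun w : n.-tuple 'I_k => word_weight p w)
    (fun w => pullback (word_map F w) phi).
Proof.
elim: n phi => [|n IH] phi hphi.
  apply/funext => a; rewrite /convex_comb (bigD1 [tuple])//= big1 => [|w].
    by rewrite addr0 /word_weight big_nil mul1r (pullback_embed FU hu).
  by move=> /eqP[]; exact: tuple0.
rewrite iterSr IH; last exact: markov_is_state.
apply/funext => a; rewrite /convex_comb big_tuple_cons exchange_big /=.
apply: eq_bigr => w _.
rewrite -[markov_op F p phi]/(convex_comb p (fun i => pullback (F i) phi)).
rewrite (pullback_convex FU hu p0 p1); last first.
  by move=> i; exact: (pullback_state FU hu).
rewrite /convex_comb mulr_sumr; apply: eq_bigr => i _.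
rewrite -pullback_word_cons//.
by rewrite /word_weight big_cons rmorphM /= mulrCA mulrA.
Qed.

Variables (phi0 : A -> R[i]) (d : R).
Hypotheses (hphi0 : is_state phi0)
  (hd : forall i, dist_le L phi0 (pullback (F i) phi0) d).

(** The radius solves [r = d + q r], so each [f_i^*] maps this ball around [phi0] into itself; the
    bound is uniform in the word. *)
Lemma word_ball w psi : is_state psi -> dist_le L phi0 psi (d / (1 - q)) ->
  dist_le L phi0 (pullback (word_map F w) psi) (d / (1 - q)).
Proof.
elim: w psi => [|i w IH] psi hpsi h; first by rewrite (pullback_embed FU hu).
rewrite pullback_word_cons//; apply: IH; first exact: (pullback_state FU hu).
have -> : d / (1 - q) = d + q * (d / (1 - q)) by field; rewrite gt_eqF.
apply: dist_le_trans (hd i) _; exact: pullback_contraction.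
Qed.

(** The weights sum to 1, so there is a letter; this gives [0 <= d]. *)
Let k_gt0 : exists i : 'I_k, true.
Proof.
apply: contrapT => hk; move: p1; rewrite big1 => [/eqP|i _].
  by rewrite eq_sym oner_eq0.
by case: hk; exists i.
Qed.

Let d0 : 0 <= d.
Proof. by have [i _] := k_gt0; exact: dist_le_ge0 (hd i). Qed.

(** One factor [d / (1 - q)] bounds the first step from [phi0] to [f_w^* phi0]; the second
    [1 / (1 - q)] is the Banach factor, as [q ^+ size w <= q] for nonempty words. *)
Let K := d / (1 - q) / (1 - q).

Lemma word_stateP w : (0 < size w)%N ->
  [/\ is_state (word_state F L phi0 w),
      pullback (word_map F w) (word_state F L phi0 w) = word_state F L phi0 w
    & dist_le L phi0 (word_state F L phi0 w) K].
Proof.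
move=> w0; have ql : q < 1 by case/andP: q01.
have qw : q ^+ size w <= q.
  case: (size w) w0 => // n _; rewrite exprS; apply: ler_piMr => //.
  by apply: exprn_ile1 => //; exact: ltW.
have qw0 : 0 <= q ^+ size w by rewrite exprn_ge0.
have dq : 0 <= d / (1 - q) by rewrite divr_ge0// ltW.
have qw01 : 0 <= q ^+ size w < 1 by rewrite qw0; lra.
have h0 : dist_le L phi0 (pullback (word_map F w) phi0) (d / (1 - q)).
  by apply: word_ball => // b sb bL; rewrite subrr rnorm0.
have [phi [hphi phiw dphi]] := contraction_fixpoint hL qw01
  (word_is_state w) (@word_contraction w) hphi0 h0.
have [] : [/\ is_state (word_state F L phi0 w),
    pullback (word_map F w) (word_state F L phi0 w) = word_state F L phi0 w
  & (state_dist L phi0 (word_state F L phi0 w) < +oo)%E].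
  apply: (@xgetPex _ (fun=> 0) [set psi | [/\ is_state psi,
    pullback (word_map F w) psi = psi & (state_dist L phi0 psi < +oo)%E]]).
  exists phi; split=> //.
  by apply/(state_dist_finP hL); eexists; exact: dphi 0%N.
set psi := word_state F L phi0 w => hpsi psiw.
move=> /(state_dist_finP hL)[c hc]; split=> //.
(* The picked state is only known to be at finite distance; uniqueness identifies it with the Banach
   fixpoint and so supplies the explicit bound [K]. *)
have -> : psi = phi.
  have := dist_le_trans (dist_le_sym hc) (dphi 0%N).
  exact: (contraction_unique hL qw01 (word_is_state w)
    (@word_contraction w)).
apply: dist_leW (dphi 0%N); rewrite expr0 mulr1 /K ler_wpM2l//.
by rewrite lef_pV2 ?posrE//; lra.
Qed.

Lemma word_average_is_state M : (0 < M)%N ->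
  is_state (word_average F p L phi0 M).
Proof.
move=> M0; apply: (convex_state FU hu (phi := fun w : M.-tuple 'I_k =>
  word_state F L phi0 w) (fun w => word_weight_ge0 w) (word_weight_sum M)).
by move=> w; have [] := @word_stateP w; rewrite ?size_tuple.
Qed.

Lemma word_average_dist M : (0 < M)%N ->
  dist_le L (word_average F p L phi0 M) (markov_iterate F p phi0 M)
    (K * q ^+ M).
Proof.
move=> M0; rewrite /markov_iterate markov_iter_words//.
apply: (@convex_dist_le _ (fun w : M.-tuple 'I_k => word_weight p w)
  (fun w => word_state F L phi0 w)) => [w||w].
- exact: word_weight_ge0.
- exact: word_weight_sum.
have [|hw ew dw] := @word_stateP w; first by rewrite size_tuple.
rewrite -{1}ew; apply: dist_le_sym.
by have := word_contraction w hphi0 hw dw; rewrite size_tuple mulrC.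
Qed.

Lemma markov_dist : dist_le L phi0 (markov_op F p phi0) d.
Proof.
move=> b sb bL.
have := @convex_dist _ _ p p0 p1 (fun=> phi0 b) (fun i => pullback (F i) phi0 b) d.
rewrite (convex_const p1); apply => i; exact: hd.
Qed.

Lemma similar_state_exists : exists phi, [/\ is_state phi,
  markov_op F p phi = phi, dist_le L phi0 phi (d / (1 - q)) &
  state_dist L (word_average F p L phi0 M) phi @[M --> \oo] --> 0%E /\
  state_dist L (markov_iterate F p phi0 M) phi @[M --> \oo] --> 0%E].
Proof.
have [phi [hphi phiT dphi]] := contraction_fixpoint hL q01 markov_is_state
  markov_contraction hphi0 markov_dist.
exists phi; split=> //; first by have := dphi 0%N; rewrite expr0 mulr1.
split; apply: state_dist_cvg0 q01 _ => n n0.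
  (* Both errors are multiples of [q ^+ n], so the constants simply add up. *)
  have := dist_le_trans (word_average_dist n0) (dphi n).
  by rewrite -mulrDl; exact.
exact: dphi.
Qed.

End SimilarStates.

(** The midpoint between 1 and the maximal dilation, clipped at 0, leaves the strict gap that
    [pullback_contraction] asks for. For the value [-oo] the choice [1 / 2] is arbitrary. *)
Lemma dilation_bound (R : realType) (A : cstarAlgType R) (L : A -> \bar R)
    (k : nat) (F : 'I_k -> A -> multiplier A) :
  (max_dilation L F < 1)%E ->
  exists2 q : R, 0 <= q < 1 & forall i, (dilation L (F i) < q%:E)%E.
Proof.
have le i : (dilation L (F i) <= max_dilation L F)%E by exact: le_bigmax.
case: (max_dilation L F) le => [r| |] le //; last first.
  by exists (1 / 2) => [|i]; [lra|apply: le_lt_trans (le i) (ltNyr _)].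
rewrite lte_fin => r1; exists ((Num.max r 0 + 1) / 2) => [|i].
  have : 0 <= Num.max r 0 by rewrite le_max lexx orbT.
  have : Num.max r 0 < 1 by rewrite gt_max r1 ltr01.
  by move=> *; apply/andP; split; lra.
apply: le_lt_trans (le i) _; rewrite lte_fin.
have : r <= Num.max r 0 by rewrite le_max lexx.
have : Num.max r 0 < 1 by rewrite gt_max r1 ltr01.
lra.
Qed.

Lemma dist_bound (R : realType) (A : cstarAlgType R) (L : A -> \bar R)
    (k : nat) (phi : A -> R[i]) (psi : 'I_k -> A -> R[i]) :
  (\big[maxe/-oo]_(i < k) state_dist L phi (psi i) < +oo)%E ->
  exists d : R, forall i, dist_le L phi (psi i) d.
Proof.
have le i : (state_dist L phi (psi i) <=
    \big[maxe/-oo]_(i < k) state_dist L phi (psi i))%E by exact: le_bigmax.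
case: (\big[_/_]_(i < k) _) le => [d| |] le // _.
  by exists d => i; apply/state_dist_leP.
by exists 0 => i; apply/state_dist_leP; exact: le_trans (le i) (leNye _).
Qed.

Local Open Scope classical_set_scope.
Local Open Scope ereal_scope.

Theorem theorem5p1 (R : realType) (A : cstarAlgType R) (L : A -> \bar R)
    (hL : complete_spectral_metric_space L)
    (hLip : forall b : A, selfadjoint b ->
      L b = lipschitz_constant L (fun phi => phi b))
    (k : nat) (F : 'I_k -> A -> multiplier A)
    (hF : forall i, relatively_proper (F i))
    (hdil : max_dilation L F < 1)
    (phi0 : A -> R[i]) (hphi0 : is_state phi0)
    (hdist : \big[maxe/-oo]_(i < k)
      state_dist L phi0 (pullback (F i) phi0) < +oo)
    (p : 'I_k -> R) (hp : open_simplex p) :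
  (forall M : nat, (0 < M)%N ->
    is_state (word_average F p L phi0 M) /\
    is_state (markov_iterate F p phi0 M)) /\
  exists phi_p : A -> R[i],
    [/\ is_state phi_p,
        state_dist L (word_average F p L phi0 M) phi_p @[M --> \oo] --> 0,
        state_dist L (markov_iterate F p phi0 M) phi_p @[M --> \oo] --> 0
      & [/\ self_similar F p phi_p,
            state_dist L phi0 phi_p < +oo
          & forall psi : A -> R[i], is_state psi -> self_similar F p psi ->
              state_dist L phi0 psi < +oo -> psi = phi_p]].
Proof.
have [D [U [u [FU hu _ _]]]] := seminorm_unit hL.
have [q q01 hq] := dilation_bound hdil.
have [d hd] := dist_bound hdist.
split=> [M M0|].
  split; first exact: (word_average_is_state hL FU hu hF hp q01 hq hphi0 hd).
  apply: contraction_iter hphi0; exact: (markov_is_state FU hu hF hp).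
have [phi [hphi phiT dphi [c1 c2]]] :=
  similar_state_exists hL FU hu hF hp q01 hq hphi0 hd.
exists phi; split=> //; split.
- by rewrite /self_similar phiT.
- by apply/(state_dist_finP hL); exists (d / (1 - q))%R.
- move=> psi hpsi psiT /(state_dist_finP hL)[c hc].
  (* Both states are at finite distance from [phi0], hence from each other, and there a contraction
     has at most one fixpoint. *)
  have := dist_le_trans (dist_le_sym hc) dphi.
  apply: (contraction_unique hL q01 (markov_is_state FU hu hF hp)
    (markov_contraction hL hp hq) hpsi hphi) => //.
Qed.
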